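(* For all $w,v\in W$, \[ \langle C_w,\widetilde C_v\rangle=\delta^{Kr}_{w,v}\prod_{\alpha\in\Sigma^+}\bigl(t-t^{-1}e^{-\alpha}\bigr). \]
   Context: Root data. Let $G$ be a semisimple simply connected complex linear algebraic group, $T\subset B$ a maximal torus inside a Borel subgroup, and $X^*(T)$ the character lattice. Let $W=N_G(T)/T$ be the Weyl group, $\Sigma$ the roots, $\Sigma^+$ the positive roots (the roots of $B$), $\Sigma^-=-\Sigma^+$, and $\Pi=\{\alpha_1,\dots,\alpha_n\}$ the simple roots. Write $s_i$ for the simple reflections, $\ell$ for the length function, $\le$ for the Bruhat order, $\epsilon_w=(-1)^{\ell(w)}$, and $w_0$ for the longest element of $W$. Twisted group algebra. Take $R=\mathbb Z[t,t^{-1},(t+t^{-1})^{-1}]$ and the multiplicative formal group law $F_m(x,y)=x+y-xy$. Let $S_m=R[[X^*(T)]]_{F_m}$, with $x_\lambda=1-e^{-\lambda}$, and let $Q_m=S_m[1/x_\alpha:\alpha\in\Sigma^+]$. Let $Q_{m,W}$ be the free left $Q_m$-module with basis $\{\delta^m_w\}_{w\in W}$, with product $(p\delta^m_w)(p'\delta^m_{w'})=p\,w(p')\,\delta^m_{ww'}$. Let $x_\Pi=\prod_{\alpha\in\Sigma^-}x_\alpha$. Dual and actions. Let $Q^*_{m,W}$ be the ring of functions $W\to Q_m$ under pointwise product, with basis $f^m_w$ (the indicator of $w$). Two actions of $Q_{m,W}$ on $Q^*_{m,W}$ are defined by - $(p\delta_v)\bullet(qf_w)=q\,wv^{-1}(p)\,f_{wv^{-1}}$,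 - $(p\delta_v)\odot(qf_w)=p\,v(q)\,f_{vw}$. Set $\mathrm{pt}^m_w:=w(x_\Pi)f^m_w$. Hecke algebra and Kazhdan–Lusztig elements. The Demazure–Lusztig elements are \[ \tau_i=\frac{t^{-1}-t}{1-e^{-\alpha_i}}+\frac{t-t^{-1}e^{-\alpha_i}}{1-e^{-\alpha_i}}\,\delta^m_{s_i}. \] They satisfy the quadratic relation $\tau_i^2=(t^{-1}-t)\tau_i+1$ and the braid relations, and they generate the Hecke algebra $H$. For a reduced word $w=s_{i_1}\cdots s_{i_k}$ set $\tau_w=\tau_{i_1}\cdots\tau_{i_k}$, and set $t_w=t^{\ell(w)}$. Let $P_{v,w}$ be the Kazhdan–Lusztig polynomials, with $P_{v,w}=0$ unless $v\le w$. Define \[ \gamma_w=\sum_{v\le w}t_wt_v^{-1}P_{v,w}(t^{-2})\tau_v,\qquad \widetilde\gamma_w=\sum_{v}\epsilon_w\epsilon_vt_w^{-1}t_vP_{v,w}(t^2)\tau_v. \] KL classes. Define \[ C_w:=\gamma_w\odot\mathrm{pt}^m_e,\qquad \widetilde C_w:=\widetilde\gamma_{w^{-1}w_0}\bullet\mathrm{pt}^m_{w_0}. \] These are viewed as classes in $K_T(G/B)[t^{\pm1}]$ via the standard identification of $K_T(G/B)$ with a subring of $Q^*_{m,W}$ by restriction to $T$-fixed points: the coefficient of $f^m_w$ is the restriction to $wB$, and $\mathrm{pt}^m_w$ is the class of the fixed point $wB$. Pairing. $\langle f,g\rangle$ is the equivariant Euler characteristic pairing on $K_T(G/B)[t^{\pm1}]$,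 i.e. $\langle f,g\rangle=Y_\Pi\bullet(fg)$. In fixed-point terms, \[ \langle f,g\rangle=\sum_{w\in W}\frac{f|_w\,g|_w}{w(x_\Pi)}. \] *)

(* Defs.v *)
From HB Require Import structures.
From mathcomp Require Import all_boot all_order all_algebra all_fingroup.
From mathcomp Require Import boolp.
Set Implicit Arguments. Unset Strict Implicit. Unset Printing Implicit Defensive.
Import Order.TTheory GRing.Theory Num.Theory.
Local Open Scope ring_scope.

(* Root datum of a semisimple simply connected group, given by its    *)
(* (generalized) Cartan matrix A, a_{ij} = <alpha_i^vee, alpha_j>.    *)
(* X^*(T) = weight lattice = Z^n in the basis of fundamental weights. *)

Definition lat (n : nat) := 'rV[int]_n.

Definition gen_cartan (n : nat) (A : 'M[int]_n) : Prop :=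
  [/\ forall i, A i i = 2,
      forall i j, i != j -> A i j <= 0
    & forall i j, (A i j == 0) = (A j i == 0)].

(* simple root alpha_j = sum_k a_{kj} omega_k *)
Definition alpha (n : nat) (A : 'M[int]_n) (j : 'I_n) : lat n :=
  \row_k A k j.

(* simple reflection s_i(lambda) = lambda - <alpha_i^vee, lambda> alpha_i *)
Definition sref (n : nat) (A : 'M[int]_n) (i : 'I_n) (l : lat n) : lat n :=
  l - (l 0 i) *: alpha A i.

Definition weyl_datum (n : nat) (A : 'M[int]_n) (gT : finGroupType)
    (s : 'I_n -> gT) (lact : gT -> lat n -> lat n) : Prop :=
  gen_cartan A /\
  (forall l, lact 1%g l = l) /\
  (forall x y l, lact (x * y)%g l = lact x (lact y l)) /\
  (forall i l, lact (s i) l = sref A i l) /\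
  (forall w, (forall l, lact w l = l) -> w = 1%g) /\
  <<[set s i | i : 'I_n]>>%g = [set: gT].

Section Coxeter.
Variables (gT : finGroupType) (n : nat) (s : 'I_n -> gT).

Definition word_prod (u : seq 'I_n) : gT := (\prod_(i <- u) s i)%g.

Definition ell (x : gT) : nat :=
  \big[minn/#|gT|]_(k < #|gT|.+1 |
      [exists u : k.-tuple 'I_n, word_prod u == x]) (k : nat).

Definition rword (x : gT) : seq 'I_n :=
  if [pick u : (ell x).-tuple 'I_n | word_prod u == x] is Some u
  then val u else [::].

Definition reflections : {set gT} :=
  [set (s i ^ x)%g | i : 'I_n, x : gT].

Definition bruhat (v w : gT) : bool :=
  connect (fun x y => [exists r in reflections, (y == x * r)%g && (ell x < ell y)%N]) v w.

Definition w0 : gT := [arg max_(w > 1%g) ell w].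

(* Kazhdan--Lusztig polynomials, via the recursion of KL79 (2.2.c):
   for w = s v > v,
   P_{x,w} = q^{1-c} P_{sx,v} + q^c P_{x,v}
             - sum_{z < v, sz < z} mu(z,v) q^{(l(w)-l(z))/2} P_{x,z},
   c = 1 if sx < x, c = 0 otherwise; P_{x,w} = 0 unless x <= w.
   The nat argument is fuel (>= l(w)). *)
Fixpoint KLr (k : nat) (x w : gT) : {poly int} :=
  match k with
  | 0 => ((x == 1%g) && (w == 1%g))%:R
  | k'.+1 =>
    if ~~ bruhat x w then 0 else
    if w == 1%g then (x == 1%g)%:R else
    if [pick i | (ell (s i * w)%g < ell w)%N] is Some i then
      let v := (s i * w)%g in
      let c : nat := (ell (s i * x)%g < ell x)%N in
      let mu z := if odd (ell v - ell z)%N then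
                    (KLr k' z v)`_(((ell v - ell z).-1./2)%N) else 0 in
      'X^(1 - c)%N * KLr k' (s i * x)%g v + 'X^c * KLr k' x v
      - \sum_(z | [&& bruhat z v, z != v & (ell (s i * z)%g < ell z)%N])
           (mu z)%:P * 'X^((ell w - ell z)./2)%N * KLr k' x z
    else 0
  end.

Definition KL (x w : gT) : {poly int} := KLr (ell w) x w.

End Coxeter.

(* K plays the role of (a field containing) Q_m: it contains t and    *)
(* e^lambda, generically (Z[t][X^*] embeds), with a W-action by ring  *)
(* automorphisms fixing t with w(e^lambda) = e^{w lambda}.            *)
Definition coeff_datum (n : nat) (gT : finGroupType) (lact : gT -> lat n -> lat n)
    (K : fieldType) (t : K) (e : lat n -> K) (act : gT -> K -> K) : Prop :=
  e 0 = 1 /\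
  (forall l m, e (l + m) = e l * e m) /\
  (forall (sq : seq (lat n)) (c : lat n -> {poly int}), uniq sq ->
          \sum_(l <- sq) (map_poly intr (c l)).[t] * e l = 0 ->
          forall l, l \in sq -> c l = 0) /\
  (forall w, act w 1 = 1 /\ forall a b, act w (a + b) = act w a + act w b
                               /\ act w (a * b) = act w a * act w b) /\
  (forall a, act 1%g a = a) /\
  (forall x y a, act (x * y)%g a = act x (act y a)) /\
  (forall w, act w t = t) /\
  (forall w l, e (lact w l) = act w (e l)).

Section Hecke.
Variables (n : nat) (A : 'M[int]_n) (gT : finGroupType) (s : 'I_n -> gT)
  (lact : gT -> lat n -> lat n) (K : fieldType) (t : K) (e : lat n -> K)
  (act : gT -> K -> K).

Definition xl (l : lat n) : K := 1 - e (- l).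

Definition roots : seq (lat n) :=
  undup [seq lact w (alpha A i) | w <- enum gT, i <- enum 'I_n].
Definition is_pos (b : lat n) : Prop :=
  exists c : 'I_n -> nat, b = \sum_i (c i)%:Z *: alpha A i.
Definition posroots : seq (lat n) := [seq b <- roots | `[< is_pos b >]].

Definition xPi : K := \prod_(b <- posroots) xl (- b).

(* Q_{m,W}: elements sum_w a(w) delta_w *)
Definition QW := {ffun gT -> K}.
Definition delta (w : gT) : QW := [ffun u => (u == w)%:R].
Definition qscale (p : K) (a : QW) : QW := [ffun u => p * a u].
Definition qadd (a b : QW) : QW := [ffun u => a u + b u].
Definition qmul (a b : QW) : QW :=
  [ffun u => \sum_(v : gT) a v * act v (b (v^-1 * u)%g)].
Definition qsum (I : Type) (r : seq I) (F : I -> QW) : QW :=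
  [ffun u => \sum_(i <- r) F i u].

Definition tau (i : 'I_n) : QW :=
  qadd (qscale ((t^-1 - t) / (1 - e (- alpha A i))) (delta 1%g))
       (qscale ((t - t^-1 * e (- alpha A i)) / (1 - e (- alpha A i))) (delta (s i))).
Definition tauw (w : gT) : QW := foldr (fun i a => qmul (tau i) a) (delta 1%g) (rword s w).

Definition tpow (w : gT) : K := t ^+ ell s w.
Definition eps (w : gT) : K := (-1) ^+ ell s w.
Definition KLev (v w : gT) (q : K) : K := (map_poly intr (KL s v w)).[q].

Definition gamma (w : gT) : QW :=
  qsum (enum gT) (fun v => qscale (if bruhat s v w then
          tpow w / tpow v * KLev v w (t ^- 2) else 0) (tauw v)).
Definition gammat (w : gT) : QW :=
  qsum (enum gT) (fun v => qscale (eps w * eps v / tpow w * tpow v * KLev v w (t ^+ 2)) (tauw v)).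

(* Q^*_{m,W}: functions W -> K; f_w the indicator of w *)
Definition QWd := {ffun gT -> K}.
(* (p delta_v) . (q f_w) = q wv^{-1}(p) f_{wv^{-1}} *)
Definition bullet (a : QW) (f : QWd) : QWd :=
  [ffun u => \sum_(v : gT) act u (a v) * f (u * v)%g].
(* (p delta_v) (.) (q f_w) = p v(q) f_{vw} *)
Definition odot (a : QW) (f : QWd) : QWd :=
  [ffun u => \sum_(v : gT) a v * act v (f (v^-1 * u)%g)].

Definition pt (w : gT) : QWd := [ffun u => if u == w then act w xPi else 0].

Definition KLC (w : gT) : QWd := odot (gamma w) (pt 1%g).
Definition KLCt (w : gT) : QWd := bullet (gammat ((w^-1 * w0 s)%g)) (pt (w0 s)).

Definition pairing (f g : QWd) : K := \sum_(w : gT) f w * g w / act w xPi.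

End Hecke.

(* Main.v *)
(* Since [pt_e] and [pt_{w0}] are supported at one point, the pairing is
   [w0(x_Pi)] times the coefficient of [delta_{w0}] in the product
   [gamma_w * gammat_u] with [u = v^-1 w0].  By length, only the leading term of
   [tau_{w0}] contributes to [delta_{w0}], and it carries the factor
   [kappa = prod_{b > 0} (t - t^-1 e^{-b}) / (1 - e^{-b})].  Let [tau'_x] be
   obtained from [tau_x] by replacing each [tau_i] with its inverse.  The
   coefficient of [delta_{w0}] in both [tau_x tau'_y] and [tau'_x tau_y] is
   [kappa] if [x y = w0], and 0 otherwise.  Bar-invariance of the
   Kazhdan-Lusztig elements expands [gamma_w] and [gammat_u] in either family, so
   the coefficient equals [kappa N(t) = kappa N(t^-1)] for one and the same
   integer polynomial [N]; as [t] is transcendental, [N] is the constant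
   [N(0)], which is 1 if [w u = w0] and 0 otherwise by the degree bound on
   Kazhdan-Lusztig polynomials. *)

Require Import Defs.
From HB Require Import structures.
From mathcomp Require Import ring zify.
From mathcomp Require Import all_boot all_order all_algebra all_fingroup.
From mathcomp Require Import boolp.
Set Implicit Arguments. Unset Strict Implicit. Unset Printing Implicit Defensive.
Import Order.TTheory GRing.Theory Num.Theory.
Local Open Scope ring_scope.

(** The element [gammat] is [gamma] with t replaced by -t^-1. This substitution fixes t^-1 - t, so
    both are values of one expression [KLelt q T], for operators obeying one quadratic relation, and
    a single lemma yields the bar-invariance of both. The Kazhdan-Lusztig polynomials are given only
    by their recursion, from which bar-invariance and the degree bound are both extracted. The
    operators are left multiplications by tau_i on functions from W to K; they are only semilinear
    over K, so the scalars that commute with them have to be tracked. As tau_w is built on an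
    arbitrarily chosen reduced word, the argument rests on the braid relations and on Matsumoto's
    theorem. These come from the root system, recovered from the finiteness of the group: a form
    averaged over W gives the sign dichotomy for roots and leaves only the rank-two types A1xA1, A2,
    B2 and G2, where the braid relations are checked by explicit expansion. *)

(** Off-diagonal terms pair up. This supplies the factor 2 by which [root_part_norm] gets an
    integral multiple of the norm of a root. *)
Lemma sym_sum_even (I : Type) (r : seq I) (P : pred I) (m : I -> I -> int) :
    (forall k l, m k l = m l k) -> (forall k, exists d, m k k = d *+ 2) ->
  exists d, \sum_(k <- r | P k) \sum_(l <- r | P l) m k l = d *+ 2.
Proof.
move=> msym mdiag; elim: r => [|a r [d IH]]; first by exists 0; rewrite big_nil.
have [Pa|nPa] := boolP (P a); last first.
  exists d; under eq_bigr do rewrite big_cons (negPf nPa).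
  by rewrite big_cons (negPf nPa) IH.
have [da Eda] := mdiag a.
exists (da + \sum_(l <- r | P l) m a l + d).
have E k : \sum_(l <- a :: r | P l) m k l = m a k + \sum_(l <- r | P l) m k l.
  by rewrite big_cons Pa msym.
by rewrite (eq_bigr _ (fun k _ => E k)) big_cons Pa big_split /= IH Eda; ring.
Qed.

(** * Roots *)

Section RootSystem.
Variables (n : nat) (A : 'M[int]_n) (gT : finGroupType)
  (s : 'I_n -> gT) (lact : gT -> lat n -> lat n).
Hypothesis WD : weyl_datum A s lact.

Local Notation alpha := (alpha A).
Local Notation pos := (is_pos A).

Let cartanP : gen_cartan A. Proof. by case: WD. Qed.
Let lact1 l : lact 1%g l = l. Proof. by case: WD => _ []. Qed.
Let lactM x y l : lact (x * y)%g l = lact x (lact y l).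
Proof. by case: WD => _ [_ []]. Qed.
Let lact_s i l : lact (s i) l = sref A i l.
Proof. by case: WD => _ [_ [_ []]]. Qed.

Lemma alphaE i k : alpha i 0 k = A k i. Proof. by rewrite mxE. Qed.

Lemma word_prod_cons i u : word_prod s (i :: u) = (s i * word_prod s u)%g.
Proof. by rewrite /word_prod big_cons. Qed.

Lemma word_prod_cat u v : word_prod s (u ++ v) = (word_prod s u * word_prod s v)%g.
Proof. by rewrite /word_prod big_cat. Qed.

Lemma word_prod_nil : word_prod s [::] = 1%g.
Proof. by rewrite /word_prod big_nil. Qed.

Lemma word_prod_rcons u i : word_prod s (rcons u i) = (word_prod s u * s i)%g.
Proof. by rewrite -cats1 word_prod_cat word_prod_cons word_prod_nil mulg1. Qed.

Lemma word_exists x : exists u, word_prod s u = x.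
Proof.
have gen : <<[set s i | i : 'I_n]>>%g = [set: gT] by case: WD => _ [_ [_ [_ []]]].
have /gen_prodgP [m [c cP ->]] : x \in <<[set s i | i : 'I_n]>>%g by rewrite gen inE.
elim: m c cP => [|m IH] c cP; first by exists [::]; rewrite word_prod_nil big_ord0.
have [u Eu] := IH (fun i => c (lift ord0 i)) (fun i => cP _).
have /imsetP [i _ Ei] := cP ord0.
by exists (i :: u); rewrite word_prod_cons big_ord_recl Ei Eu.
Qed.

Lemma weyl_ind (P : gT -> Prop) :
  P 1%g -> (forall i x, P x -> P (s i * x)%g) -> forall x, P x.
Proof.
move=> P1 PM x; have [u <-] := word_exists x.
by elim: u => [|i u IH]; rewrite ?word_prod_nil // word_prod_cons; apply: PM.
Qed.

Lemma lactD w l m : lact w (l + m) = lact w l + lact w m.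
Proof.
elim/weyl_ind: w l m => [|i x IH] l m; first by rewrite !lact1.
rewrite !lactM IH !lact_s /sref mxE scalerDl opprD !addrA; congr (_ - _).
by rewrite -!addrA; congr (_ + _); rewrite addrC.
Qed.

Lemma lactZ w (c : int) l : lact w (c *: l) = c *: lact w l.
Proof.
elim/weyl_ind: w l => [|i x IH] l; first by rewrite !lact1.
by rewrite !lactM IH !lact_s /sref mxE -scalerA -scalerBr.
Qed.

Lemma lactN w l : lact w (- l) = - lact w l.
Proof. by rewrite -scaleN1r lactZ scaleN1r. Qed.

Lemma lact0 w : lact w 0 = 0.
Proof. by rewrite -(scale0r 0) lactZ !scale0r. Qed.

Lemma lact_sum w (I : Type) (r : seq I) (P : pred I) F :
  lact w (\sum_(k <- r | P k) F k) = \sum_(k <- r | P k) lact w (F k).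
Proof. by apply: (big_morph _ (lactD w) (lact0 w)). Qed.

Lemma lactK w : cancel (lact w) (lact w^-1%g).
Proof. by move=> l; rewrite -lactM mulVg lact1. Qed.

Lemma lactKV w : cancel (lact w^-1%g) (lact w).
Proof. by move=> l; rewrite -lactM mulgV lact1. Qed.

Lemma alpha_refl i : lact (s i) (alpha i) = - alpha i.
Proof.
rewrite lact_s /sref alphaE; case: cartanP => -> _ _.
by rewrite scaler_nat mulr2n opprD addrA subrr add0r.
Qed.

Lemma lact_faithful x y : (forall l, lact x l = lact y l) -> x = y.
Proof.
move=> xy; have faith : forall w, (forall l, lact w l = l) -> w = 1%g.
  by case: WD => _ [_ [_ [_ []]]].
apply: (mulIg y^-1%g); rewrite mulgV; apply: faith => l.
by rewrite lactM xy lactKV.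
Qed.

Lemma ss1 i : (s i * s i)%g = 1%g.
Proof.
apply: lact_faithful => l; rewrite lactM lact1 lact_s /sref lact_s /sref !mxE.
case: cartanP => Aii _ _; rewrite Aii -addrA -opprD -scalerDl.
set c := (X in X *: _); suff -> : c = 0 by rewrite scale0r subr0.
by rewrite /c; ring.
Qed.

Lemma sV i : (s i)^-1%g = s i.
Proof. by apply/eqP; rewrite eq_sym -mulg_eq1 ss1. Qed.

Lemma sK i x : (s i * (s i * x))%g = x.
Proof. by rewrite mulgA ss1 mul1g. Qed.

Lemma Ks i x : (x * s i * s i)%g = x.
Proof. by rewrite -mulgA ss1 mulg1. Qed.

(* Averaging the standard form over [W]. *)
Definition ip (l m : lat n) : int :=
  \sum_w \sum_k lact w l 0 k * lact w m 0 k.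

Lemma ipC l m : ip l m = ip m l.
Proof. by apply: eq_bigr => w _; apply: eq_bigr => k _; rewrite mulrC. Qed.

Lemma ipDl l l' m : ip (l + l') m = ip l m + ip l' m.
Proof.
rewrite -big_split /=; apply: eq_bigr => w _; rewrite -big_split /=.
by apply: eq_bigr => k _; rewrite lactD mxE mulrDl.
Qed.

Lemma ipZl c l m : ip (c *: l) m = c * ip l m.
Proof.
rewrite mulr_sumr; apply: eq_bigr => w _; rewrite mulr_sumr.
by apply: eq_bigr => k _; rewrite lactZ mxE mulrA.
Qed.

Lemma ipNl l m : ip (- l) m = - ip l m.
Proof. by rewrite -scaleN1r ipZl mulN1r. Qed.

Lemma ip0l m : ip 0 m = 0.
Proof. by rewrite -(scale0r 0) ipZl mul0r. Qed.

Lemma ip_suml (I : Type) (r : seq I) (P : pred I) F m :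
  ip (\sum_(k <- r | P k) F k) m = \sum_(k <- r | P k) ip (F k) m.
Proof. by apply: (big_morph (ip^~ m) (fun l l' => ipDl l l' m) (ip0l m)). Qed.

Lemma ip_act w l m : ip (lact w l) (lact w m) = ip l m.
Proof.
rewrite /ip [RHS](reindex_inj (mulIg w)) /=.
by apply: eq_bigr => x _; apply: eq_bigr => k _; rewrite !lactM.
Qed.

Lemma ip_ge0 l : 0 <= ip l l.
Proof. by apply: sumr_ge0 => w _; apply: sumr_ge0 => k _; rewrite -expr2 sqr_ge0. Qed.

Lemma ip_gt0 l : l != 0 -> 0 < ip l l.
Proof.
move=> l0; rewrite lt_def ip_ge0 andbT; apply: contra l0 => l0.
apply/eqP/rowP => k; rewrite mxE.
have sq0 w : 0 <= \sum_k lact w l 0 k * lact w l 0 k.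
  by apply: sumr_ge0 => j _; rewrite -expr2 sqr_ge0.
move: l0; rewrite /ip psumr_eq0 // => /allP /(_ 1%g).
rewrite mem_index_enum lact1 => /(_ isT) /=.
rewrite psumr_eq0 => [/allP /(_ k)|j _]; last by rewrite -expr2 sqr_ge0.
by rewrite mem_index_enum => /(_ isT) /=; rewrite mulf_eq0 orbb => /eqP.
Qed.

Lemma alpha_neq0 i : alpha i != 0.
Proof.
apply/eqP => /rowP /(_ i); rewrite alphaE mxE.
by case: cartanP => -> _ _.
Qed.

(** Invariance of the form under [s i] identifies the i-th coordinate of a weight with its pairing
    against the coroot 2 alpha_i / (alpha_i, alpha_i). *)
Lemma ip_coord (l : lat n) i : l 0 i * ip (alpha i) (alpha i) = ip l (alpha i) *+ 2.
Proof.
have := ip_act (s i) l (alpha i); rewrite alpha_refl lact_s /sref.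
rewrite ipC ipNl ipC ipDl ipNl ipZl => E.
by rewrite mulr2n -[X in _ = X + _]E; ring.
Qed.

Lemma ip_alpha k l : A k l * ip (alpha k) (alpha k) = ip (alpha k) (alpha l) *+ 2.
Proof. by rewrite -alphaE ip_coord ipC. Qed.

Lemma ip_omega (c : 'I_n -> int) k :
  ip (\sum_l c l *: alpha l) (delta_mx 0 k) *+ 2 = c k * ip (alpha k) (alpha k).
Proof.
rewrite ip_suml -sumrMnl (bigD1 k) //= big1 ?addr0 => [|l lk].
  by rewrite ipZl -mulrnAr ipC -ip_coord mxE !eqxx mul1r.
by rewrite ipZl -mulrnAr ipC -ip_coord mxE (negPf lk) andbF mul0r mulr0.
Qed.

(** Pairing with the fundamental weight [delta_mx 0 k] isolates the k-th coefficient, so the Cartan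
    matrix is nondegenerate because W is finite. *)
Lemma alpha_free (c : 'I_n -> int) : \sum_l c l *: alpha l = 0 -> forall k, c k = 0.
Proof.
move=> c0 k; have := ip_omega c k; rewrite c0 ip0l mul0rn => /esym/eqP.
by rewrite mulf_eq0 (gt_eqF (ip_gt0 (alpha_neq0 k))) orbF => /eqP.
Qed.

Lemma root_coords w i : exists c : 'I_n -> int, lact w (alpha i) = \sum_l c l *: alpha l.
Proof.
elim/weyl_ind: w => [|j x [c IH]].
  exists (fun l => (l == i)%:R); rewrite lact1 (bigD1 i) //= eqxx scale1r.
  by rewrite big1 ?addr0 // => l /negPf ->; rewrite scale0r.
rewrite lactM IH lact_s /sref; set d := (_ 0 j).
exists (fun l => c l - d * (l == j)%:R).
under [RHS]eq_bigr do rewrite scalerBl.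
rewrite sumrB; congr (_ - _); rewrite (bigD1 j) //= eqxx mulr1.
by rewrite big1 ?addr0 // => l /negPf ->; rewrite mulr0 scale0r.
Qed.

(* The coefficients of the coroot of [w alpha_i] are integers as well. *)
Lemma root_coord_dual w i (c : 'I_n -> int) :
    lact w (alpha i) = \sum_l c l *: alpha l ->
  forall k, c k * ip (alpha k) (alpha k)
    = lact w^-1%g (delta_mx 0 k) 0 i * ip (alpha i) (alpha i).
Proof.
move=> wc k; rewrite -ip_omega -wc ip_coord; congr (_ *+ 2).
by rewrite -[in RHS](ip_act w) lactKV ipC.
Qed.

(** With d_k the coefficients of the coroot, the integers d_k c_l A_kl are 2 c_k c_l (alpha_k,
    alpha_l) divided by the norm of the root. They form a symmetric matrix with even diagonal 2 d_k
    c_k, so [sym_sum_even] applies. *)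
Lemma root_part_norm w i (c : 'I_n -> int) (P : pred 'I_n) :
    lact w (alpha i) = \sum_l c l *: alpha l ->
  exists d, ip (\sum_(l | P l) c l *: alpha l) (\sum_(l | P l) c l *: alpha l)
    = d * ip (alpha i) (alpha i).
Proof.
move=> wc; pose m k l := lact w^-1%g (delta_mx 0 k) 0 i * c l * A k l.
have Bi : ip (alpha i) (alpha i) != 0 by rewrite gt_eqF ?ip_gt0 ?alpha_neq0.
have mE k l : m k l * ip (alpha i) (alpha i)
    = c k * c l * (ip (alpha k) (alpha l) *+ 2).
  by rewrite -ip_alpha /m !mulrA [LHS]mulrAC [X in X * _]mulrAC -(root_coord_dual wc); ring.
have [|k|d Ed] := @sym_sum_even _ (index_enum 'I_n) P m.
- by move=> k l; apply: (mulIf Bi); rewrite !mE ipC; congr (_ * _); rewrite mulrC.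
- by exists (lact w^-1%g (delta_mx 0 k) 0 i * c k); rewrite /m; case: cartanP => -> _ _; ring.
exists d; apply: (@pmulrnI _ 2 isT); rewrite -mulrnAl -Ed mulr_suml ip_suml.
rewrite -sumrMnl; apply: eq_bigr => k _.
rewrite mulr_suml ipZl ipC ip_suml -mulrnAr -sumrMnl mulr_sumr; apply: eq_bigr => l _.
by rewrite mE ipZl ipC -mulrnAr; ring.
Qed.

(* Writing a root as [b = p - q] with [p], [q] nonnegative of disjoint supports,
   [(p, q) <= 0], so [(b, b) >= (p, p) + (q, q)]; by integrality both norms are
   multiples of [(b, b)], hence one of them vanishes. *)
Lemma root_sign w i : pos (lact w (alpha i)) \/ pos (- lact w (alpha i)).
Proof.
have [c wc] := root_coords w i.
have B0 : 0 < ip (alpha i) (alpha i) by rewrite ip_gt0 ?alpha_neq0.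
pose p := \sum_(l | 0 < c l) c l *: alpha l.
(* Here [q] keeps its nonpositive coefficients, so the root is [p + q] and the inequality on the
   pairing reads [0 <= ip p q]. *)
pose q := \sum_(l | ~~ (0 < c l)) c l *: alpha l.
have wpq : lact w (alpha i) = p + q by rewrite wc (bigID (fun l => 0 < c l)).
have pq0 : 0 <= ip p q.
  rewrite /p ip_suml; apply: sumr_ge0 => k ck; rewrite ipZl mulr_ge0 ?(ltW ck) //.
  rewrite ipC /q ip_suml; apply: sumr_ge0 => l; rewrite -leNgt => cl.
  rewrite ipZl mulr_le0 // -(pmulrn_lle0 _ (n := 2)) // ipC -ip_alpha.
  rewrite mulr_le0_ge0 ?(ltW (ip_gt0 (alpha_neq0 k))) //.
  case: cartanP => _ Aneg _; apply: Aneg; apply/eqP => kl.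
  by move: cl; rewrite -kl leNgt ck.
have [d Ed] := root_part_norm (fun l => 0 < c l) wc.
have [d' Ed'] := root_part_norm (fun l => ~~ (0 < c l)) wc.
rewrite -/p in Ed; rewrite -/q in Ed'.
have nE : ip (alpha i) (alpha i) = ip p p + ip q q + ip p q *+ 2.
  by rewrite -(ip_act w) wpq ipDl ![ip _ (p + q)]ipC !ipDl [ip q p]ipC; ring.
have [p0|p0] := eqVneq p 0.
  right; exists (fun l => `|c l|%N); rewrite wc -sumrN; apply: eq_bigr => l _.
  rewrite -scaleNr; congr (_ *: _).
  suff cl : c l <= 0 by lia.
  have : (if 0 < c l then c l else 0) = 0; last by case: ifP; lia.
  apply: (@alpha_free (fun l => if 0 < c l then c l else 0)).
  apply: etrans p0; rewrite /p [RHS]big_mkcond; apply: eq_bigr => k _.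
  by case: ifP => // _; rewrite scale0r.
have [q0|q0] := eqVneq q 0.
  left; exists (fun l => `|c l|%N); rewrite wc; apply: eq_bigr => l _.
  congr (_ *: _); suff cl : 0 <= c l by lia.
  have : (if ~~ (0 < c l) then c l else 0) = 0; last by case: ifP; lia.
  apply: (@alpha_free (fun l => if ~~ (0 < c l) then c l else 0)).
  apply: etrans q0; rewrite /q [RHS]big_mkcond; apply: eq_bigr => k _.
  by case: ifP => // _; rewrite scale0r.
have := ip_gt0 p0; have := ip_gt0 q0; rewrite Ed Ed' !pmulr_lgt0 // => d0 d0'.
by move: nE; rewrite Ed Ed' => nE; nia.
Qed.

Lemma posN b : pos b -> pos (- b) -> b = 0.
Proof.
move=> [c Ec] [d Ed]; have cd : forall k, (c k)%:Z + (d k)%:Z = 0.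
  apply: alpha_free; under eq_bigr do rewrite scalerDl.
  by rewrite big_split /= -Ec -Ed subrr.
rewrite Ec big1 // => k _; have := cd k; case: (c k) => [|m]; first by rewrite scale0r.
by move=> /eqP; lia.
Qed.

Definition is_root b := exists w i, b = lact w (alpha i).

Lemma is_root_act w b : is_root b -> is_root (lact w b).
Proof. by move=> [x [i ->]]; exists (w * x)%g, i; rewrite lactM. Qed.

Lemma is_root_alpha i : is_root (alpha i).
Proof. by exists 1%g, i; rewrite lact1. Qed.

Lemma is_root_opp b : is_root b -> is_root (- b).
Proof. by move=> [x [i ->]]; exists (x * s i)%g, i; rewrite lactM alpha_refl lactN. Qed.

Lemma is_root_neq0 b : is_root b -> b != 0.
Proof.
move=> [x [i ->]]; apply: contra (alpha_neq0 i) => /eqP E.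
by rewrite -(lactK x (alpha i)) E lact0.
Qed.

Lemma is_root_sign b : is_root b -> pos b \/ pos (- b).
Proof. by move=> [x [i ->]]; apply: root_sign. Qed.

Lemma root_posN b : is_root b -> pos b -> ~ pos (- b).
Proof.
by move=> rb pb nb; move: (is_root_neq0 rb); rewrite (posN pb nb) eqxx.
Qed.

Lemma pos_alpha i : pos (alpha i).
Proof.
exists (fun l => (l == i)%N); rewrite (bigD1 i) //= eqxx scale1r.
by rewrite big1 ?addr0 // => l /negPf ->; rewrite scale0r.
Qed.

Lemma posD b b' : pos b -> pos b' -> pos (b + b').
Proof.
move=> [c ->] [d ->]; exists (fun l => (c l + d l)%N); rewrite -big_split /=.
by apply: eq_bigr => l _; rewrite PoszD scalerDl.
Qed.

Lemma posMn b k : pos b -> pos (b *+ k).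
Proof.
move=> [c ->]; exists (fun l => (c l * k)%N); rewrite -sumrMnl.
by apply: eq_bigr => l _; rewrite PoszM mulrC -scalerA -scaler_nat natz.
Qed.

(** Only the i-th coefficient changes under [s i], so a change of sign forces b = c alpha_i. The
    coroot coefficient x of b is an integer with x c = 1, hence c = 1. *)
Lemma pos_refl i b : is_root b -> pos b -> b != alpha i -> pos (lact (s i) b).
Proof.
move=> rb [c Ec] bi.
have [//|[d Ed]] := is_root_sign (is_root_act (s i) rb).
have Es : lact (s i) b = b - (b 0 i) *: alpha i by rewrite lact_s.
have ck k : k != i -> c k = 0%N.
  have := @alpha_free (fun k => (c k)%:Z + (d k)%:Z - (b 0 i) * (k == i)%:R) _ k.
  move=> E ki; move: E; rewrite (negPf ki) mulr0 subr0 => E.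
  suff /E/eqP : \sum_l ((c l)%:Z + (d l)%:Z - b 0 i * (l == i)%:R) *: alpha l = 0 by lia.
  under eq_bigr do rewrite scalerBl scalerDl.
  rewrite sumrB big_split /= -Ec -Ed Es.
  rewrite [X in _ - X](bigD1 i) //= eqxx mulr1 big1 => [|l /negPf ->]; last first.
    by rewrite mulr0 scale0r.
  by rewrite addr0 opprB [b + _]addrC subrK subrr.
have bc : b = (c i)%:Z *: alpha i.
  by rewrite Ec (bigD1 i) //= big1 ?addr0 // => l li; rewrite ck // scale0r.
case: rb => w [j bw]; have wc : lact w (alpha j) = \sum_l (c l)%:Z *: alpha l.
  by rewrite -bw.
have := root_coord_dual wc i; have -> : ip (alpha j) (alpha j) = ip b b.
  by rewrite bw ip_act.
rewrite bc ipZl ipC ipZl !mulrA => /mulIf E.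
have B0 : ip (alpha i) (alpha i) != 0 by rewrite gt_eqF ?ip_gt0 ?alpha_neq0.
have {}E := E B0; have c1 : c i = 1%N.
  have c0 : c i != 0%N.
    apply: contra (alpha_neq0 j) => /eqP c0.
    by rewrite -(lactK w (alpha j)) -bw bc c0 scale0r lact0.
  move: E; set x := (_ 0 j); move: (c i) c0 => m m0 E.
  have {}E : x * m%:Z = 1.
    by apply: (@mulIf _ m%:Z); [move: m0; lia | rewrite mul1r -E].
  have x0 : 0 < x by move: m0 E; nia.
  by move: m0 E x0; nia.
by move: bi; rewrite bc c1 scale1r eqxx.
Qed.

End RootSystem.

(** * Length, exchange and Bruhat order *)

Lemma bigminn_le (I : eqType) (r : seq I) (P : pred I) (F : I -> nat) N i :
  i \in r -> P i -> (\big[minn/N]_(k <- r | P k) F k <= F i)%N.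
Proof.
elim: r => // a r IH; rewrite in_cons big_cons => /orP [/eqP <- ->|ir Pi].
  exact: geq_minl.
by case: ifP => _; rewrite ?geq_min IH ?orbT.
Qed.

Lemma bigminn_le_idx (I : Type) (r : seq I) (P : pred I) (F : I -> nat) N :
  (\big[minn/N]_(k <- r | P k) F k <= N)%N.
Proof.
elim: r => [|a r IH]; first by rewrite big_nil.
by rewrite big_cons; case: ifP => // _; rewrite geq_min IH orbT.
Qed.

Lemma bigminn_attained (I : Type) (r : seq I) (P : pred I) (F : I -> nat) N :
  \big[minn/N]_(k <- r | P k) F k = N
  \/ exists2 i, P i & \big[minn/N]_(k <- r | P k) F k = F i.
Proof.
elim/big_ind: _ => [|x y IHx IHy|i Pi]; [by left| |by right; exists i].
by rewrite /minn; case: ifP.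
Qed.

Section Length.
Variables (n : nat) (A : 'M[int]_n) (gT : finGroupType)
  (s : 'I_n -> gT) (lact : gT -> lat n -> lat n).
Hypothesis WD : weyl_datum A s lact.

Local Notation alpha := (alpha A).
Local Notation pos := (is_pos A).
Local Notation wp := (word_prod s).
Local Notation ell := (ell s).

Let lact1 l : lact 1%g l = l. Proof. by case: WD => _ []. Qed.
Let lactM x y l : lact (x * y)%g l = lact x (lact y l).
Proof. by case: WD => _ [_ []]. Qed.

(** The prefixes of a shortest word have distinct products, and there is one more of them than
    letters. Hence the cap #|gT| in the definition of [ell] is never the value returned. *)
Lemma short_word_bound u :
  (forall u', wp u' = wp u -> (size u <= size u')%N) -> (size u < #|gT|)%N.
Proof.
move=> umin; pose F (k : 'I_(size u).+1) := wp (take k u).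
suff injF : injective F by have := leq_card F injF; rewrite card_ord.
suff injF (a b : 'I_(size u).+1) : (a < b)%N -> F a <> F b.
  move=> a b Fab; apply/val_inj; case: (ltngtP (val a) (val b)) => // ab.
    by have := injF _ _ ab.
  by have := injF _ _ ab; rewrite Fab.
move=> ab Fab; have := umin (take a u ++ drop b u).
rewrite word_prod_cat -/(F a) Fab -word_prod_cat cat_take_drop => /(_ erefl).
have := ltn_ord b; have := ltn_ord a.
by rewrite size_cat size_drop (size_takel (leq_ord a)); lia.
Qed.

Lemma ell_le u : (ell (wp u) <= size u)%N.
Proof.
have [uG|uG] := leqP (size u) #|gT|; last first.
  by apply: leq_trans (ltnW uG); apply: bigminn_le_idx.
rewrite -ltnS in uG; rewrite /Defs.ell.
pose k := Ordinal uG.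
apply: (@bigminn_le _ _ _ (fun k : 'I_(#|gT|.+1) => k : nat) _ k).
  exact: mem_index_enum.
by apply/existsP; exists (in_tuple u).
Qed.

Lemma ell_tuple x : exists u : (ell x).-tuple 'I_n, wp u == x.
Proof.
rewrite /Defs.ell.
case: (@bigminn_attained _ (index_enum 'I_#|gT|.+1)
    (fun k : 'I_#|gT|.+1 => [exists u : k.-tuple 'I_n, wp u == x]) val #|gT|)
  => [E|[k /existsP [u ux] ->]]; last by exists u.
have ex : exists k, [exists u : k.-tuple 'I_n, wp u == x].
  have [u ux] := word_exists WD x.
  by exists (size u); apply/existsP; exists (in_tuple u); rewrite ux.
case: (ex_minnP ex) => k /existsP [u /eqP ux] kmin.
have kG : (k < #|gT|)%N.
  rewrite -[k](size_tuple u); apply: short_word_bound => u' u'u.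
  rewrite size_tuple; apply: kmin; apply/existsP; exists (in_tuple u').
  by rewrite u'u ux.
by have := ell_le u; rewrite ux size_tuple /Defs.ell E leqNgt kG.
Qed.

Lemma ell_word x : exists2 u, size u = ell x & wp u = x.
Proof. by have [u /eqP ux] := ell_tuple x; exists u; rewrite ?size_tuple. Qed.

Lemma rwordP x : size (rword s x) = ell x /\ wp (rword s x) = x.
Proof.
rewrite /rword; case: pickP => [u /eqP ux|nu]; first by rewrite size_tuple.
by have [u] := ell_tuple x; rewrite nu.
Qed.

Lemma ell1 : ell 1%g = 0%N.
Proof. by have := ell_le [::]; rewrite word_prod_nil leqn0 => /eqP. Qed.

Lemma ell_eq0 x : ell x = 0%N -> x = 1%g.
Proof. by move=> x0; have [[|i u]] := ell_word x; rewrite x0 // word_prod_nil. Qed.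

Lemma word_prod_rev u : wp (rev u) = (wp u)^-1%g.
Proof.
elim: u => [|i u IH]; first by rewrite word_prod_nil invg1.
by rewrite rev_cons word_prod_rcons IH word_prod_cons invMg (sV WD).
Qed.

Lemma ellV x : ell x^-1%g = ell x.
Proof.
suff le y : (ell y^-1%g <= ell y)%N by apply/eqP; rewrite eqn_leq le -{1}[x]invgK le.
by have [u <- <-] := ell_word y; rewrite -word_prod_rev -(size_rev u) ell_le.
Qed.

Lemma ell_sl_le i x : (ell (s i * x)%g <= (ell x).+1)%N.
Proof. by have [u <- {1}<-] := ell_word x; rewrite -word_prod_cons (ell_le (i :: u)). Qed.

Lemma ell_sr_le i x : (ell (x * s i)%g <= (ell x).+1)%N.
Proof. by rewrite -ellV invMg (sV WD) -(ellV x) ell_sl_le. Qed.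

Definition refl_of (r : gT) (b : lat n) :=
  exists g i, b = lact g (alpha i) /\ r = (g * s i * g^-1)%g.

Lemma refl_of_simple i : refl_of (s i) (alpha i).
Proof. by exists 1%g, i; rewrite lact1 mul1g invg1 mulg1. Qed.

Lemma refl_of_root r b : refl_of r b -> is_root A lact b.
Proof. by move=> [g [i [-> _]]]; exists g, i. Qed.

Lemma refl_of_act r b : refl_of r b -> lact r b = - b.
Proof.
move=> [g [i [-> ->]]].
by rewrite !lactM (lactK WD) (alpha_refl WD) (lactN WD).
Qed.

Lemma refl_ofV r b : refl_of r b -> (r * r = 1)%g.
Proof. by move=> [g [i [_ ->]]]; rewrite !mulgA mulgKV (Ks WD) mulgV. Qed.

(** By [ip_coord] the invariant form determines the coroot from the root, so both sides act on
    weights by the same formula. *)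
Lemma conj_simple h i j : lact h (alpha i) = alpha j -> (h * s i * h^-1)%g = s j.
Proof.
case: WD => _ [_ [_ [lact_s _]]] hij; apply: (lact_faithful WD) => l.
rewrite !lactM !lact_s /sref (lactD WD) (lactN WD) (lactZ WD) (lactKV WD) hij.
have B0 : ip lact (alpha j) (alpha j) != 0.
  by rewrite gt_eqF ?(ip_gt0 WD) ?(alpha_neq0 WD).
have BB : ip lact (alpha j) (alpha j) = ip lact (alpha i) (alpha i).
  by rewrite -hij (ip_act WD).
congr (_ - _ *: _); apply: (mulIf B0); rewrite {1}BB !(ip_coord WD).
by rewrite -(ip_act WD h) (lactKV WD) hij.
Qed.

Lemma refl_of_conj x r b i : refl_of r b -> lact x b = alpha i -> (x * r)%g = (s i * x)%g.
Proof.
move=> [g [j [-> ->]]]; rewrite -lactM => /conj_simple <-.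
by rewrite invMg !mulgA mulgKV.
Qed.

(** Strong exchange. Reading the word from the right, the letter that turns the image of b negative
    meets it at its own simple root ([pos_refl]); deleting that letter amounts to multiplying by
    r. *)
Lemma exchange u r b : refl_of r b -> pos b -> pos (- lact (wp u) b) ->
  exists2 u', (size u' < size u)%N & wp u' = (wp u * r)%g.
Proof.
move=> rb pb; have root_b := refl_of_root rb; elim: u => [|a u IH].
  rewrite word_prod_nil lact1 => nb.
  by case: (root_posN WD root_b pb nb).
have [/IH [u' su' Eu'] _|pu] := pselect (pos (- lact (wp u) b)).
  by exists (a :: u'); rewrite // !word_prod_cons Eu' mulgA.
have root_ub : is_root A lact (lact (wp u) b) by apply: (is_root_act WD).
have {}pu : pos (lact (wp u) b) by case: (is_root_sign WD root_ub).
rewrite word_prod_cons lactM => nu.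
have [E|E] := eqVneq (lact (wp u) b) (alpha a).
  by exists u; rewrite //= -mulgA (refl_of_conj rb E) (sK WD).
by case: (root_posN WD (is_root_act WD (s a) root_ub) (pos_refl WD root_ub pu E) nu).
Qed.

Lemma ell_refl_lt x r b : refl_of r b -> pos b -> pos (- lact x b) -> (ell (x * r)%g < ell x)%N.
Proof.
move=> rb pb; have [u <- <-] := ell_word x => nb.
have [u' su' <-] := exchange rb pb nb.
by apply: leq_ltn_trans su'; apply: ell_le.
Qed.

Lemma ell_refl_gt x r b : refl_of r b -> pos b -> pos (lact x b) -> (ell x < ell (x * r)%g)%N.
Proof.
move=> rb pb xb; have := @ell_refl_lt (x * r)%g r b rb pb.
rewrite lactM (refl_of_act rb) (lactN WD) opprK -mulgA (refl_ofV rb) mulg1.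
by apply.
Qed.

Lemma ell_sr_gtP x i : pos (lact x (alpha i)) -> ell (x * s i)%g = (ell x).+1.
Proof.
move=> /(ell_refl_gt (refl_of_simple i) (pos_alpha A i)) gt.
by apply/eqP; rewrite eqn_leq ell_sr_le.
Qed.

Lemma ell_sr_ltP x i : pos (- lact x (alpha i)) -> ell x = (ell (x * s i)%g).+1.
Proof.
move=> /(ell_refl_lt (refl_of_simple i) (pos_alpha A i)) lt.
by apply/eqP; rewrite eqn_leq lt andbT -{1}(Ks WD i x) ell_sr_le.
Qed.

Lemma ell_sl_gtP x i : pos (lact x^-1%g (alpha i)) -> ell (s i * x)%g = (ell x).+1.
Proof. by move=> /ell_sr_gtP; rewrite ellV -ellV invMg invgK (sV WD). Qed.

Lemma ell_sl_ltP x i : pos (- lact x^-1%g (alpha i)) -> ell x = (ell (s i * x)%g).+1.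
Proof. by move=> /ell_sr_ltP; rewrite ellV => ->; rewrite -ellV invMg invgK (sV WD). Qed.

Lemma ell_sl x i :
  (ell (s i * x)%g = (ell x).+1 /\ pos (lact x^-1%g (alpha i)))
  \/ (ell x = (ell (s i * x)%g).+1 /\ pos (- lact x^-1%g (alpha i))).
Proof.
have [p|p] := is_root_sign WD (is_root_act WD x^-1%g (is_root_alpha WD i)).
  by left; rewrite ell_sl_gtP.
by right; rewrite -ell_sl_ltP.
Qed.

Lemma ell_sr x i :
  (ell (x * s i)%g = (ell x).+1 /\ pos (lact x (alpha i)))
  \/ (ell x = (ell (x * s i)%g).+1 /\ pos (- lact x (alpha i))).
Proof.
have [p|p] := is_root_sign WD (is_root_act WD x (is_root_alpha WD i)).
  by left; rewrite ell_sr_gtP.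
by right; rewrite -ell_sr_ltP.
Qed.

Lemma descent_exists x : x != 1%g -> exists i, (ell (s i * x)%g < ell x)%N.
Proof.
have [[|i u]] := ell_word x => [_ <-|su xu _]; first by rewrite word_prod_nil eqxx.
by exists i; rewrite -su -xu word_prod_cons (sK WD) ltnS ell_le.
Qed.

Lemma descent_existsr x : x != 1%g -> exists i, (ell (x * s i)%g < ell x)%N.
Proof.
rewrite -invg_eq1 => /descent_exists [i]; rewrite ellV -ellV invMg invgK (sV WD).
by exists i.
Qed.

Local Notation edge :=
  (fun x y : gT => [exists r in reflections s, (y == x * r)%g && (ell x < ell y)%N]).

Lemma reflectionsP r : r \in reflections s -> exists2 b, refl_of r b & pos b.
Proof.
move=> /imset2P [i x _ _ ->]; set b := lact x^-1%g (alpha i).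
have rb : refl_of (s i ^ x)%g b by exists x^-1%g, i; rewrite /conjg invgK !mulgA.
have [pb|pb] := is_root_sign WD (refl_of_root rb); first by exists b.
exists (- b) => //; exists (x^-1 * s i)%g, i; split.
  by rewrite lactM (alpha_refl WD) (lactN WD).
by rewrite /conjg invMg invgK (sV WD) !mulgA (Ks WD).
Qed.

(** The edge is witnessed by the positive root x b. Applying [s i] keeps it positive unless it is
    [alpha i], and then y is [s i * x]. *)
Lemma edge_lift i x y : edge x y -> (s i * x)%g = y \/ edge (s i * x)%g (s i * y)%g.
Proof.
move=> /existsP [r /andP [rR /andP [/eqP -> lxy]]].
have [b rb pb] := reflectionsP rR; have root_xb := is_root_act WD x (refl_of_root rb).
have [pxb|nxb] := is_root_sign WD root_xb; last first.
  by have := ell_refl_lt rb pb nxb; rewrite ltnNge (ltnW lxy).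
have [E|E] := eqVneq (lact x b) (alpha i); first by left; rewrite (refl_of_conj rb E).
right; apply/existsP; exists r; rewrite rR mulgA eqxx /=.
by apply: (ell_refl_gt rb pb); rewrite lactM; apply: (pos_refl WD).
Qed.

Lemma bruhat_refl x : bruhat s x x. Proof. exact: connect0. Qed.

Lemma bruhat_trans y x z : bruhat s x y -> bruhat s y z -> bruhat s x z.
Proof. exact: connect_trans. Qed.

Lemma bruhat_ell x y : bruhat s x y -> x = y \/ (ell x < ell y)%N.
Proof.
move=> /connectP [p]; elim: p x => [|z p IH] x /=; first by left.
move=> /andP [/existsP [r /andP [_ /andP [_ xz]]] zp] /IH -/(_ zp) [<-|zy]; right => //.
exact: ltn_trans zy.
Qed.

Lemma bruhat_ell_le x y : bruhat s x y -> (ell x <= ell y)%N.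
Proof. by case/bruhat_ell => [->|/ltnW]. Qed.

Lemma bruhat_up i x : (ell x < ell (s i * x)%g)%N -> bruhat s x (s i * x)%g.
Proof.
move=> lx; apply: connect1; apply/existsP; exists (s i ^ x)%g.
rewrite lx andbT /conjg mulKVg eqxx andbT.
by apply/imset2P; exists i x.
Qed.

(** Lifting property, by carrying a chain below v through [edge_lift]. It lets [KLval_rec] drop the
    Bruhat guard of the recursion. *)
Lemma bruhat_lift i x v :
  bruhat s (s i * x)%g v -> (ell v < ell (s i * v)%g)%N -> bruhat s x (s i * v)%g.
Proof.
move=> xv lv; have v_siv := bruhat_up lv.
suff H y : bruhat s y v -> bruhat s (s i * y)%g v \/ bruhat s (s i * y)%g (s i * v)%g.
  by have := H _ xv; rewrite (sK WD) => -[/bruhat_trans|//]; apply.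
move=> /connectP [p]; elim: p y => [|z p IH] y /=.
  by move=> _ ->; right; apply: bruhat_refl.
move=> /andP [yz zp] Ev; have zv : bruhat s z v by apply/connectP; exists p.
case: (edge_lift i yz) => [->|yz']; first by left.
case: (IH _ zp Ev) => H; [left|right]; apply: bruhat_trans H; exact: connect1.
Qed.

Local Notation w0 := (w0 s).

Lemma ell_w0_max x : (ell x <= ell w0)%N.
Proof. by rewrite /Defs.w0; case: arg_maxnP => // w _ /(_ x); apply. Qed.

(** [w0] is only known as some element of maximal length; maximality excludes a longer w0 s_i. *)
Lemma w0_alpha i : pos (- lact w0 (alpha i)).
Proof.
by case: (ell_sr w0 i) => [[E _]|[]//]; have := ell_w0_max (w0 * s i)%g; rewrite E ltnn.
Qed.

Lemma ell_w0M z : (ell (w0 * z)%g + ell z)%N = ell w0.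
Proof.
move Ek : (ell z) => k; elim: k z Ek => [|k IH] z Ek.
  by rewrite (ell_eq0 Ek) mulg1 addn0.
have /descent_existsr [i] : z != 1%g.
  by apply/eqP => z1; rewrite z1 ell1 in Ek.
case: (ell_sr z i) => [[-> _]|[Ez pz _]]; first by rewrite ltnNge leqnSn.
have Ek' : ell (z * s i)%g = k by move: Ez; rewrite Ek => -[].
have := IH _ Ek'; rewrite mulgA => <-.
suff : pos (lact (w0 * z)%g (alpha i)) by move/ell_sr_gtP => ->; lia.
have [c Ec] := pz; rewrite lactM -[lact z _]opprK Ec (lactN WD) (lact_sum WD) -sumrN.
elim/big_ind: _ => [|x y px py|l _].
- by exists (fun=> 0%N); rewrite big1 // => l _; rewrite scale0r.
- exact: posD.
rewrite (lactZ WD) -scalerN; have [d ->] := w0_alpha l.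
exists (fun j => (c l * d j)%N); rewrite scaler_sumr; apply: eq_bigr => j _.
by rewrite scalerA PoszM.
Qed.

Lemma w0_square : (w0 * w0)%g = 1%g.
Proof. by apply: ell_eq0; have := ell_w0M w0; lia. Qed.

Lemma w0V : w0^-1%g = w0.
Proof. by apply/eqP; rewrite eq_sym -mulg_eq1 w0_square. Qed.

Lemma w0_pos b : pos b -> pos (- lact w0 b).
Proof.
move=> [c ->]; rewrite (lact_sum WD) -sumrN.
elim/big_ind: _ => [|x y px py|l _].
- by exists (fun=> 0%N); rewrite big1 // => l _; rewrite scale0r.
- exact: posD.
rewrite (lactZ WD) -scalerN; have [d ->] := w0_alpha l.
exists (fun j => (c l * d j)%N); rewrite scaler_sumr; apply: eq_bigr => j _.
by rewrite scalerA PoszM.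
Qed.

Lemma mem_roots b : reflect (is_root A lact b) (b \in Defs.roots A lact).
Proof.
rewrite mem_undup; apply: (iffP allpairsP) => [[[w i] [_ _ ->]]|[w [i ->]]].
  by exists w, i.
by exists (w, i); rewrite /= !mem_enum.
Qed.

Lemma mem_posroots b : b \in posroots A lact <-> is_root A lact b /\ pos b.
Proof.
rewrite mem_filter; split=> [/andP [/asboolP pb /mem_roots rb]//|[rb pb]].
by apply/andP; split; [apply/asboolP|apply/mem_roots].
Qed.

Lemma posroots_uniq : uniq (posroots A lact).
Proof. by rewrite filter_uniq ?undup_uniq. Qed.

Lemma lact_inj w : injective (lact w).
Proof. exact: can_inj (lactK WD w). Qed.

Lemma perm_posroots i :
  perm_eq [seq lact (s i) b | b <- posroots A lact & b != alpha i]
          [seq b <- posroots A lact | b != alpha i].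
Proof.
have sub : {subset [seq lact (s i) b | b <- posroots A lact & b != alpha i]
    <= [seq b <- posroots A lact | b != alpha i]}.
  move=> x /mapP [b]; rewrite mem_filter => /andP [bi /mem_posroots [rb pb]] {x}->.
  rewrite mem_filter; apply/andP; split; last first.
    by apply/mem_posroots; split; [apply: (is_root_act WD)|apply: (pos_refl WD)].
  apply/eqP => E; have E' : b = - alpha i.
    by rewrite -(alpha_refl WD) -E -lactM (ss1 WD) lact1.
  move: (alpha_neq0 WD i); rewrite (posN WD (pos_alpha A i)) ?eqxx //.
  by rewrite -E'.
have u1 : uniq [seq lact (s i) b | b <- posroots A lact & b != alpha i].
  by rewrite (map_inj_uniq (@lact_inj (s i))) filter_uniq // posroots_uniq.
apply: uniq_perm => //; first by rewrite filter_uniq // posroots_uniq.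
by apply: (uniq_min_size u1 sub _).2; rewrite size_map.
Qed.

(** The inversions of s_i x are alpha_i and the s_i-images of those of x. The statement is
    multiplicative because the leading coefficient in [foldr_op_lead] is accumulated in this way. *)
Lemma prod_inversions_cons (K : comRingType) (f : lat n -> K) i x :
    (ell x < ell (s i * x)%g)%N ->
  \prod_(b <- posroots A lact | `[< pos (- lact (s i * x)^-1%g b) >]) f b
  = f (alpha i) * \prod_(b <- posroots A lact | `[< pos (- lact x^-1%g b) >]) f (lact (s i) b).
Proof.
case: (ell_sl x i) => [[_ px _]|[-> _]]; last by rewrite ltnNge leqnSn.
have pai : alpha i \in posroots A lact.
  by apply/mem_posroots; split; [apply: (is_root_alpha WD)|apply: pos_alpha].
have Einv b : lact (s i * x)^-1%g b = lact x^-1%g (lact (s i) b).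
  by rewrite invMg (sV WD) lactM.
rewrite -big_filter (bigD1_seq (alpha i)) /=; last first.
- by rewrite filter_uniq // posroots_uniq.
- rewrite mem_filter pai andbT; apply/asboolP.
  by rewrite Einv (alpha_refl WD) (lactN WD) opprK.
congr (_ * _); rewrite big_filter_cond (eq_bigl (fun b => (b != alpha i) &&
  `[< pos (- lact (s i * x)^-1%g b) >])) => [|b]; last by rewrite andbC.
rewrite -big_filter_cond -(perm_big _ (perm_posroots i)) /= big_map big_filter_cond.
apply: eq_big => b /=; last by [].
(* The reindexed side omits [alpha i]; by [px] it is not an inversion of [x], so the two index sets
   agree. *)
rewrite Einv -(lactM (s i) (s i)) (ss1 WD) lact1; case: eqVneq => // -> /=.
by apply/esym/asboolP; apply: (root_posN WD) px; apply/(is_root_act WD)/(is_root_alpha WD).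
Qed.
End Length.

(** * Braid relations in rank two *)

Fixpoint alt_word (T : Type) (x y : T) (k : nat) : seq T :=
  if k is k'.+1 then x :: alt_word y x k' else [::].

(* A pair [(p, q)] stands for the root [p alpha + q beta]; the letters [false]
   and [true] stand for the reflections in [alpha] and [beta]. *)
Definition rank2_refl (a b : int) (l : bool) (r : int * int) : int * int :=
  if l then (r.1, b * r.1 - r.2) else (a * r.2 - r.1, r.2).
Definition rank2_simple (l : bool) : int * int := if l then (0, 1) else (1, 0).
Definition rank2_opp (l : bool) : int * int := if l then (0, -1) else (-1, 0).

(* [(mono, (l, k))] stands for the product of the scalars in [mono] times the
   alternating word of length [k] with first letter [l]. *)
Notation alt_term := (seq (int * int) * (bool * nat))%type.

(** Left multiplication by [rank2_op l]. The scalar part leaves the word alone. The [D] part twists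
    the scalars by the reflection, then either prepends its letter or cancels an equal first letter,
    which by [D2] leaves two terms. *)
Definition alt_step (a b : int) (l : bool) (t : alt_term) : seq alt_term :=
  let: (mono, (l', k)) := t in
  let mono' := map (rank2_refl a b l) mono in
  (rank2_simple l :: mono, (l', k)) ::
  if (l == l') && (0 < k)%N then
    [:: (mono', (~~ l, k.-1));
        (rank2_simple l :: rank2_opp l :: mono', (~~ l, k.-1))]
  else [:: (mono', (l, k.+1))].

Definition alt_expand (a b : int) (u : seq bool) : seq alt_term :=
  foldr (fun l st => flatten (map (alt_step a b l) st)) [:: ([::], (false, 0%N))] u.

(** The first letter is forgotten at length 0, where there is none, and at length m, where the two
    alternating words define the same operator. *)
Definition alt_key (m : nat) (w : bool * nat) : bool * nat :=
  (w.1 && (w.2 \notin [:: 0; m]%N), w.2).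

Definition alt_keys (m : nat) : seq (bool * nat) :=
  undup (map (alt_key m) (allpairs pair [:: false; true] (iota 0 m.+1))).

Definition alt_coef (m : nat) (st : seq alt_term) (w : bool * nat) : seq (seq (int * int)) :=
  [seq t.1 | t <- st & alt_key m t.2 == w].

Section Braid.
Variables (K : fieldType) (V : lmodType K).
Variables (S : bool -> K -> K) (D : bool -> V -> V) (av : int * int -> K).
Variables (a b : int).
Hypotheses (DD : forall l f g, D l (f + g) = D l f + D l g)
  (DZ : forall l k f, D l (k *: f) = S l k *: D l f)
  (S1 : forall l, S l 1 = 1) (SM : forall l x y, S l (x * y) = S l x * S l y)
  (Sav : forall l r, S l (av r) = av (rank2_refl a b l r))
  (D2 : forall l f, D l (D l f)
     = (1 + av (rank2_simple l) * av (rank2_opp l)) *: f).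

(* Both sides of the braid relation are expanded in the alternating words in [D];
   the coefficients are polynomials in the values of [av], compared by [field]. *)
Definition rank2_op l f := av (rank2_simple l) *: f + D l f.

Definition mono_eval (mono : seq (int * int)) : K := foldr (fun r z => av r * z) 1 mono.

Definition coef_eval (ms : seq (seq (int * int))) : K :=
  foldr (fun mono z => mono_eval mono + z) 0 ms.

Definition alt_op (w : bool * nat) f := foldr D f (alt_word w.1 (~~ w.1) w.2).

Definition alt_eval (st : seq alt_term) f : V :=
  \sum_(t <- st) mono_eval t.1 *: alt_op t.2 f.

Lemma D0 l : D l 0 = 0.
Proof. by apply: (addrI (D l 0)); rewrite -DD !addr0. Qed.

Lemma S_mono l mono : S l (mono_eval mono) = mono_eval (map (rank2_refl a b l) mono).
Proof. by elim: mono => [|r mono IH] /=; rewrite ?S1 // SM Sav IH. Qed.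

Lemma alt_step_eval l t f : rank2_op l (mono_eval t.1 *: alt_op t.2 f)
  = alt_eval (alt_step a b l t) f.
Proof.
case: t => mono [l' k]; rewrite /rank2_op DZ S_mono scalerA /= /alt_eval big_cons /=.
congr (_ + _); case: ifP => [/andP [/eqP <- k0]|lk]; last first.
  rewrite big_seq1 /= /alt_op /=; congr (_ *: D l _); congr (foldr _ _ _).
  by case: k lk => // k /=; rewrite andbT; case: l; case: l'.
case: k k0 => // k _; rewrite big_cons big_seq1 -scalerDl /alt_op /= D2 scalerA negbK.
by congr (_ *: _); ring.
Qed.

Lemma rank2_op_sum l (I : Type) (r : seq I) F :
  rank2_op l (\sum_(i <- r) F i) = \sum_(i <- r) rank2_op l (F i).
Proof.
rewrite /rank2_op scaler_sumr (big_morph (D l) (DD l) (D0 l)).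
by rewrite -big_split.
Qed.

Lemma alt_expand_eval u f : foldr rank2_op f u = alt_eval (alt_expand a b u) f.
Proof.
elim: u => [|l u IH] /=; first by rewrite /alt_eval big_seq1 scale1r.
rewrite IH /alt_eval rank2_op_sum big_flatten /= big_map.
by apply: eq_bigr => t _; rewrite alt_step_eval.
Qed.

Lemma coef_evalE ms : coef_eval ms = \sum_(mono <- ms) mono_eval mono.
Proof. by elim: ms => [|m ms IH]; rewrite ?big_nil // big_cons -IH. Qed.

Lemma alt_eval_coef m st f :
    alt_op (false, m) f = alt_op (true, m) f ->
    all (fun t => alt_key m t.2 \in alt_keys m) st ->
  alt_eval st f = \sum_(w <- alt_keys m) coef_eval (alt_coef m st w) *: alt_op w f.
Proof.
move=> top; rewrite /alt_eval; under [in RHS]eq_bigr do rewrite coef_evalE /alt_coef.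
elim: st => [|t st IH] /=.
  by rewrite !big_nil big1 // => w _; rewrite scale0r.
move=> /andP [tm /IH {}IH]; rewrite big_cons IH.
rewrite [in RHS](bigD1_seq _ tm) ?undup_uniq //= eqxx /= big_cons scalerDl -addrA.
rewrite [in LHS](bigD1_seq _ tm) ?undup_uniq //=; congr (_ *: _ + (_ + _)).
  case: t.2 => l k; rewrite /alt_key /= !inE negb_or; case: l => //=.
  case: eqVneq => [->|_] //=; case: eqVneq => [->|//].
  by rewrite top.
by apply: eq_bigr => w /negPf wt; rewrite eq_sym wt.
Qed.

Lemma alt_braid m f :
    alt_op (false, m) f = alt_op (true, m) f ->
    (forall l, all (fun t => alt_key m t.2 \in alt_keys m)
       (alt_expand a b (alt_word l (~~ l) m))) ->
    (forall w, w \in alt_keys m ->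
       coef_eval (alt_coef m (alt_expand a b (alt_word false true m)) w)
       = coef_eval (alt_coef m (alt_expand a b (alt_word true false m)) w)) ->
  foldr rank2_op f (alt_word false true m) = foldr rank2_op f (alt_word true false m).
Proof.
move=> top keys coefs; rewrite !alt_expand_eval.
rewrite (alt_eval_coef top (keys false)) (alt_eval_coef top (keys true)).
by apply: eq_big_seq => w wm; rewrite coefs.
Qed.

Section Coefficients.
Variables (c x y : K).
Hypotheses (x0 : x != 0) (y0 : y != 0)
  (xy1 : forall p q : nat, (0 < p + q)%N -> 1 - x ^+ p * y ^+ q != 0)
  (avE : forall p q, av (p, q) = c / (1 - x ^ p * y ^ q)).

Lemma av_pos (p q : nat) : av (Posz p, Posz q) = c / (1 - x ^+ p * y ^+ q).
Proof. by rewrite avE. Qed.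

(** The identity c/(1 - z^-1) = c - c/(1 - z) removes the negative roots, so that [field] only meets
    denominators attached to positive ones. *)
Lemma av_opp (p q : nat) : (0 < p + q)%N ->
  av (- p%:Z, - q%:Z) = c - c / (1 - x ^+ p * y ^+ q).
Proof.
move=> pq; rewrite avE -!invr_expz -invfM.
have z1 := xy1 pq; have : x ^+ p * y ^+ q != 0 by rewrite mulf_neq0 // expf_neq0.
rewrite -!exprnP; set z := x ^+ p * y ^+ q in z1 * => z0.
have z2 : 1 - z^-1 != 0.
  by rewrite subr_eq0 -invr1 (inj_eq invr_inj) -subr_eq0.
by field; rewrite z0 z1 /= -opprB oppr_eq0.
Qed.

Lemma av_neg p q : av (Negz p, Negz q) = c - c / (1 - x ^+ p.+1 * y ^+ q.+1).
Proof. by rewrite -av_opp. Qed.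

Lemma av_neg0 p : av (Negz p, 0) = c - c / (1 - x ^+ p.+1 * y ^+ 0).
Proof. by rewrite -av_opp ?addn0. Qed.

Lemma av_0neg q : av (0, Negz q) = c - c / (1 - x ^+ 0 * y ^+ q.+1).
Proof. by rewrite -av_opp. Qed.

Ltac alt_coef_compute :=
  match goal with |- coef_eval ?u = coef_eval ?v =>
    let u' := eval vm_compute in u in let v' := eval vm_compute in v in
    change u with u'; change v with v'
  end;
  rewrite /coef_eval /mono_eval /= ?(av_neg, av_neg0, av_0neg, av_pos).

Ltac alt_braid_compute :=
  split; [by case; vm_cast_no_check (erefl true)|];
  match goal with |- context [alt_keys ?m] =>
    let ks := eval vm_compute in (alt_keys m) in
    have -> : alt_keys m = ks by vm_cast_no_check (erefl ks)
  end;
  let w := fresh in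
  move=> w; rewrite !in_cons in_nil orbF; do ?case/orP; move=> /eqP ->;
  alt_coef_compute; try reflexivity.

(** Types A1xA1, A2, B2 and G2 with both orderings of the simple roots; the last entry is the order
    of s_i s_j. *)
Definition rank2_types : seq (int * int * nat) :=
  [:: (0, 0, 2%N); (1, 1, 3%N); (1, 2, 4%N); (2, 1, 4%N); (1, 3, 6%N); (3, 1, 6%N)].

Lemma braid_rank2 m f : (a, b, m) \in rank2_types ->
    alt_op (false, m) f = alt_op (true, m) f ->
  foldr rank2_op f (alt_word false true m) = foldr rank2_op f (alt_word true false m).
Proof.
(* These exponents are the coordinates of all positive roots of the listed rank-two systems. *)
have := (@xy1 1 0 isT, @xy1 0 1 isT, @xy1 1 1 isT, @xy1 1 2 isT, @xy1 2 1 isT).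
have := (@xy1 1 3 isT, @xy1 3 1 isT, @xy1 2 3 isT, @xy1 3 2 isT).
rewrite !expr0 !expr1 !mulr1 !mul1r => n2 n1 types top.
suff [] : (forall l, all (fun t => alt_key m t.2 \in alt_keys m)
       (alt_expand a b (alt_word l (~~ l) m))) /\
    (forall w, w \in alt_keys m ->
       coef_eval (alt_coef m (alt_expand a b (alt_word false true m)) w)
       = coef_eval (alt_coef m (alt_expand a b (alt_word true false m)) w)).
  exact: alt_braid top.
move: types; rewrite !in_cons in_nil orbF; do ?case/orP; move=> /eqP [-> -> ->].
all: alt_braid_compute.
all: by field; rewrite ?n1 ?n2.
Qed.
End Coefficients.
End Braid.

(** * Rank-two subsystems of the root system *)

Section RankTwo.
Variables (n : nat) (A : 'M[int]_n) (gT : finGroupType)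
  (s : 'I_n -> gT) (lact : gT -> lat n -> lat n).
Hypothesis WD : weyl_datum A s lact.

Local Notation alpha := (alpha A).
Local Notation pos := (is_pos A).
Local Notation wp := (word_prod s).
Local Notation ell := (ell s).

Let lact1 l : lact 1%g l = l. Proof. by case: WD => _ []. Qed.
Let lactM x y l : lact (x * y)%g l = lact x (lact y l).
Proof. by case: WD => _ [_ []]. Qed.
Let lact_s i l : lact (s i) l = sref A i l.
Proof. by case: WD => _ [_ [_ []]]. Qed.

(** Strict Cauchy-Schwarz for the independent alpha_i and alpha_j: A_ij A_ji equals 4 z^2 / (X Y),
    and the vector Y alpha_i - z alpha_j has positive norm. *)
Lemma cartan_prod_lt4 i j : i != j -> A i j * A j i < 4.
Proof.
move=> ij; set X := ip lact (alpha i) (alpha i); set Y := ip lact (alpha j) (alpha j).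
set z := ip lact (alpha i) (alpha j).
have X0 : 0 < X by rewrite (ip_gt0 WD) ?(alpha_neq0 WD).
have Y0 : 0 < Y by rewrite (ip_gt0 WD) ?(alpha_neq0 WD).
have EX : A i j * X = z *+ 2 by rewrite (ip_alpha WD).
have EY : A j i * Y = z *+ 2 by rewrite (ip_alpha WD) ipC.
have v0 : Y *: alpha i - z *: alpha j != 0.
  apply/eqP => v0; pose c l := Y * (l == i)%:R - z * (l == j)%:R.
  have := @alpha_free _ _ _ _ _ WD c _ i; rewrite /c eqxx (negPf ij) mulr0 subr0 mulr1.
  move=> E; move: Y0; rewrite E ?ltxx // -[RHS]v0.
  under eq_bigr do rewrite scalerBl.
  rewrite sumrB (bigD1 i) //= eqxx mulr1 big1 => [|l /negPf ->]; last by rewrite mulr0 scale0r.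
  rewrite (bigD1 j) //= eqxx mulr1 big1 => [|l /negPf ->]; last by rewrite mulr0 scale0r.
  by rewrite !addr0.
have := ip_gt0 WD v0.
rewrite (ipDl WD) !(ipC _ _ (_ - _)) !(ipDl WD) !(ipNl WD) !(ipZl WD).
rewrite !(ipC _ _ (- _)) !(ipNl WD) !(ipC _ _ (_ *: _)) !(ipZl WD) -/X -/Y.
rewrite (ipC _ (alpha j)) -/z => cs.
have zz : z * z < X * Y.
  rewrite -subr_gt0 -(pmulr_rgt0 _ Y0); move: cs; congr (_ < _); ring.
have : A i j * A j i * (X * Y) < 4 * (X * Y).
  have -> : A i j * A j i * (X * Y) = 4 * (z * z).
    by transitivity ((A i j * X) * (A j i * Y)); [ring|rewrite EX EY; ring].
  by rewrite ltr_pM2l.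
by rewrite ltr_pM2r // mulr_gt0.
Qed.

Lemma rank2_typeP i j : i != j ->
  exists m, (- A i j, - A j i, m) \in rank2_types.
Proof.
move=> ij; have := cartan_prod_lt4 ij.
case: WD => -[_ Aneg Az] _; have := Aneg _ _ ij; rewrite eq_sym in ij.
have := Aneg _ _ ij; have := Az i j.
set p := A i j; set q := A j i => pq q0 p0 pq4.
have : exists a b : nat, p = - a%:Z /\ q = - b%:Z.
  by exists `|p|%N, `|q|%N; lia.
move=> [a [b [Ep Eq]]]; rewrite Ep Eq !opprK in pq pq4 *.
have ab : (a * b < 4)%N by move: pq4; rewrite mulrNN -PoszM; lia.
rewrite !oppr_eq0 in pq.
case: a ab pq {pq4 Ep} => [|a]; case: b {Eq} => [|b] //.
  by exists 2%N.
move=> ab _; have ab' : ((a <= 2) && (b <= 2))%N by nia.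
case: a ab ab' => [|[|[|a]]] //; case: b => [|[|[|b]]] // _ _.
- by exists 3%N.
- by exists 4%N.
- by exists 6%N.
- by exists 4%N.
- by exists 6%N.
Qed.

Section Pair.
Variables (i j : 'I_n).
Hypothesis ij : i != j.
Let a := - A i j.
Let b := - A j i.

Definition pair_letter (l : bool) := if l then j else i.
Definition pair_root (r : int * int) : lat n := r.1 *: alpha i + r.2 *: alpha j.

Lemma alt_word_map k l :
  alt_word (pair_letter l) (pair_letter (~~ l)) k = map pair_letter (alt_word l (~~ l) k).
Proof.
elim: k l => //= k IH l; congr (_ :: _).
by rewrite -{2}(negbK l) IH negbK.
Qed.

Let Aii k : A k k = 2. Proof. by case: WD => -[]. Qed.

Lemma lact_pair_root l r :
  lact (s (pair_letter l)) (pair_root r) = pair_root (rank2_refl a b l r).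
Proof.
rewrite lact_s /sref /pair_root !mxE; case: l; rewrite /= !Aii.
  rewrite -addrA -scalerBl; congr (_ + _ *: _); rewrite /b; ring.
by rewrite addrAC -scalerBl; congr (_ *: _ + _); rewrite /a; ring.
Qed.

Lemma pair_root_simple l : pair_root (rank2_simple l) = alpha (pair_letter l).
Proof. by case: l; rewrite /pair_root /= scale0r scale1r ?addr0 ?add0r. Qed.

Lemma pair_root_opp l : pair_root (rank2_opp l) = - alpha (pair_letter l).
Proof. by case: l; rewrite /pair_root /= scale0r ?addr0 ?add0r scaleN1r. Qed.

Lemma pair_root_eq0 p q : pair_root (p, q) = 0 -> p = 0 /\ q = 0.
Proof.
move=> r0; pose c l := p * (l == i)%:R + q * (l == j)%:R.
have c0 : \sum_l c l *: alpha l = 0.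
  rewrite -[RHS]r0 /c /pair_root; under eq_bigr do rewrite scalerDl.
  rewrite big_split (bigD1 i) //= eqxx mulr1 big1 => [|l /negPf ->]; last by rewrite mulr0 scale0r.
  rewrite (bigD1 j) //= eqxx mulr1 big1 => [|l /negPf ->]; last by rewrite mulr0 scale0r.
  by rewrite !addr0.
have := alpha_free WD c0 i; have := alpha_free WD c0 j.
by rewrite /c !eqxx (negPf ij) eq_sym (negPf ij); lia.
Qed.

Definition rank2_inv (u : seq bool) : seq (int * int) :=
  foldr (fun l rs => rank2_simple l :: map (rank2_refl a b l) rs) [::] u.

(* Image of [mu + r.1 alpha_i + r.2 alpha_j], where [mu] has coordinates [z]
   against the two coroots, minus [mu]. *)
Definition rank2_affine (z : int * int) (l : bool) (r : int * int) : int * int :=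
  if l then (r.1, b * r.1 - r.2 - z.2) else (a * r.2 - r.1 - z.1, r.2).

Lemma lact_affine l (mu : lat n) r :
  lact (s (pair_letter l)) (mu + pair_root r)
  = mu + pair_root (rank2_affine (mu 0 i, mu 0 j) l r).
Proof.
rewrite (lactD WD) lact_pair_root lact_s /sref -addrA; congr (_ + _).
case: l; rewrite /pair_root /=; first by rewrite addrCA [- _ + _]addrC -scalerBl.
by rewrite addrA [- _ + _]addrC -scalerBl.
Qed.

Lemma lact_affine_word u (mu : lat n) :
  lact (wp (map pair_letter u)) mu
  = mu + pair_root (foldr (rank2_affine (mu 0 i, mu 0 j)) (0, 0) u).
Proof.
elim: u => [|l u IH].
  by rewrite word_prod_nil lact1 /pair_root /= !scale0r !addr0.
by rewrite /= word_prod_cons lactM IH lact_affine.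
Qed.

Variable m : nat.
Hypothesis mP : (a, b, m) \in rank2_types.

(** A weight enters only through its two coordinates against the coroots, so each type reduces to
    identities linear in [z1] and [z2]. *)
Lemma group_braid : wp (alt_word i j m) = wp (alt_word j i m).
Proof.
rewrite (alt_word_map m false) (alt_word_map m true).
apply: (lact_faithful WD) => mu; rewrite !lact_affine_word; congr (_ + pair_root _).
rewrite /rank2_affine; move: (mu 0 i) (mu 0 j) => z1 z2.
move: mP; rewrite !in_cons in_nil orbF; do ?case/orP; move=> /eqP [-> -> ->] /=.
all: by congr pair; ring.
Qed.

(** Both words spell the longest element of the dihedral group, so each list enumerates the positive
    roots of the rank-two system. *)
Lemma rank2_inv_perm :
  perm_eq (rank2_inv (alt_word false true m)) (rank2_inv (alt_word true false m)).
Proof.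
rewrite /rank2_inv; move: mP.
rewrite !in_cons in_nil orbF; do ?case/orP; move=> /eqP [-> -> ->].
all: by vm_cast_no_check (erefl true).
Qed.

Lemma rank2_inv_ge0 r : r \in rank2_inv (alt_word false true m) -> 0 <= r.1 /\ 0 <= r.2.
Proof.
suff : all (fun r => (0 <= r.1) && (0 <= r.2)) (rank2_inv (alt_word false true m)).
  by move=> /allP P /P /andP.
rewrite /rank2_inv; move: mP.
rewrite !in_cons in_nil orbF; do ?case/orP; move=> /eqP [-> -> ->].
all: by vm_cast_no_check (erefl true).
Qed.

Lemma pair_root_neg x r : 0 <= r.1 -> 0 <= r.2 ->
    pos (- lact x (alpha i)) -> pos (- lact x (alpha j)) ->
  pos (- lact x (pair_root r)).
Proof.
case: r => -[p|//] [q|//] _ _ xi xj; rewrite /pair_root (lactD WD) !(lactZ WD) opprD.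
rewrite -!scalerN; apply: posD.
  by rewrite /= -[Posz p]natz scaler_nat; apply: posMn.
by rewrite /= -[Posz q]natz scaler_nat; apply: posMn.
Qed.

(* The hypotheses say that [s_i] and [s_j] are left descents of [x]. *)
Lemma alt_prefix x : pos (- lact x^-1%g (alpha i)) -> pos (- lact x^-1%g (alpha j)) ->
  ell x = (m + ell ((wp (alt_word i j m))^-1 * x)%g)%N.
Proof.
move=> xi xj; rewrite (alt_word_map m false) /=.
have E : (m = size (alt_word false true m))%N.
  by move: false true; elim: (m) => //= k IH l l'; rewrite -IH.
rewrite {1}E {E}.
have : {in rank2_inv (alt_word false true m), forall r, pos (- lact x^-1%g (pair_root r))}.
  by move=> r /rank2_inv_ge0 [r1 r2]; apply: pair_root_neg.
elim: (alt_word false true m) x {xi xj} => [|l u IH] x inv.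
  by rewrite word_prod_nil invg1 mul1g.
rewrite /= word_prod_cons invMg (sV WD) -mulgA addSn -IH.
  apply: (ell_sl_ltP WD); rewrite -pair_root_simple; apply: inv; exact: mem_head.
move=> r ru; rewrite invMg (sV WD) lactM lact_pair_root; apply: inv.
by rewrite /= in_cons map_f ?orbT.
Qed.
End Pair.
End RankTwo.

(** * Independence of the reduced word *)

Lemma alt_wordSr (T : Type) (x y : T) k :
  alt_word x y k.+1 = rcons (alt_word x y k) (if odd k then y else x).
Proof.
elim: k x y => // k IH x y; rewrite -[LHS]/(x :: alt_word y x k.+1) IH /=.
by case: (odd k).
Qed.

Lemma rev_alt_word (T : Type) (x y : T) k :
  rev (alt_word x y k) = if odd k then alt_word x y k else alt_word y x k.
Proof.
elim: k x y => // k IH x y; rewrite [in LHS]alt_wordSr rev_rcons IH /=.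
by case: (odd k).
Qed.

Section Matsumoto.
Variables (n : nat) (A : 'M[int]_n) (gT : finGroupType)
  (s : 'I_n -> gT) (lact : gT -> lat n -> lat n).
Hypothesis WD : weyl_datum A s lact.

Local Notation wp := (word_prod s).
Local Notation ell := (ell s).

Definition reduced (u : seq 'I_n) := size u = ell (wp u).

Lemma reduced_rword x : reduced (rword s x).
Proof. by have [su ux] := rwordP WD x; rewrite /reduced ux. Qed.

Lemma reduced_tail i u : reduced (i :: u) -> reduced u.
Proof.
rewrite /reduced /= word_prod_cons => E; apply/eqP.
rewrite eqn_leq (ell_le s u) andbT -ltnS E; exact: (ell_sl_le WD).
Qed.

Lemma size_alt_word (T : Type) (x y : T) k : size (alt_word x y k) = k.
Proof. by elim: k x y => //= k IH x y; rewrite IH. Qed.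

Lemma reduced_descent i u : reduced (i :: u) ->
  is_pos A (- lact (wp (i :: u))^-1%g (alpha A i)).
Proof.
move=> red; case: (ell_sl WD (wp (i :: u)) i) => [[E _]|[]//]; exfalso.
have := ell_le s u; move: E; rewrite -red /= word_prod_cons (sK WD) => ->.
by rewrite ltnNge leqnSn.
Qed.

Section Operators.
Variables (V : Type) (T : 'I_n -> V -> V).

Definition satisfies_braid := forall i j m X, i != j ->
  (- A i j, - A j i, m) \in rank2_types ->
  foldr T X (alt_word i j m) = foldr T X (alt_word j i m).

Hypothesis braid : satisfies_braid.

(** If the first letters i and j differ, both are left descents, so [alt_prefix] splits off the
    longest element of the dihedral group. Then u and v are compared with reduced words starting
    with its two spellings: [same] handles equal first letters and [braid] exchanges the
    spellings. *)
Lemma matsumoto u v X : reduced u -> reduced v -> wp u = wp v ->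
  foldr T X u = foldr T X v.
Proof.
move Ek : (size u) => k; elim: k u v Ek => [|k IH] u v su ru rv uv.
  case: u su ru uv => // _ _ uv.
  by case: v uv rv => // j v uv; rewrite /reduced -uv word_prod_nil (ell1 s).
have sv : size v = k.+1 by rewrite rv -uv -ru.
have same i u1 v1 : size u1 = k -> reduced (i :: u1) -> reduced (i :: v1) ->
    wp (i :: u1) = wp (i :: v1) -> foldr T X (i :: u1) = foldr T X (i :: v1).
  move=> su1 ru1 rv1; rewrite !word_prod_cons => /mulgI E /=.
  by rewrite (IH u1 v1) //; apply: reduced_tail; eassumption.
case: u su ru uv => // i u [su] ru uv; case: v sv rv uv => // j v [sv] rv uv.
have [E|ij] := eqVneq i j; first by rewrite E in ru uv *; apply: same.
have [m mP] := rank2_typeP WD ij.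
have gb := group_braid WD mP; set w := wp (i :: u) in uv.
have wi : is_pos A (- lact w^-1%g (alpha A i)) := reduced_descent ru.
have wj : is_pos A (- lact w^-1%g (alpha A j)) by rewrite uv; apply: reduced_descent.
have pre := alt_prefix WD mP wi wj.
set x := (_^-1 * w)%g in pre; have [sx xE] := rwordP WD x.
have wx : w = (wp (alt_word i j m) * x)%g by rewrite /x mulKVg.
have m0 : exists m', m = m'.+1.
  move: mP; rewrite !in_cons in_nil orbF.
  by do ?case/orP; move=> /eqP [_ _ ->]; eexists; reflexivity.
have [m' Em] := m0.
have Ei : wp (alt_word i j m ++ rword s x) = w by rewrite word_prod_cat xE.
have Ej : wp (alt_word j i m ++ rword s x) = w by rewrite word_prod_cat xE -gb.
have ri : reduced (alt_word i j m ++ rword s x).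
  by rewrite /reduced Ei size_cat size_alt_word sx pre.
have rj : reduced (alt_word j i m ++ rword s x).
  by rewrite /reduced Ej size_cat size_alt_word sx pre.
transitivity (foldr T X (alt_word i j m ++ rword s x)).
  by move: ri Ei; rewrite Em => ri Ei; apply: same; rewrite ?Ei.
rewrite foldr_cat (braid _ ij mP) -foldr_cat.
by move: rj Ej; rewrite Em => rj Ej; apply/esym; apply: same; rewrite ?Ej.
Qed.

Definition word_op (w : gT) (X : V) := foldr T X (rword s w).

Lemma word_op1 X : word_op 1%g X = X.
Proof.
by rewrite /word_op; have [] := rwordP WD 1%g; rewrite (ell1 s); case: (rword s 1%g).
Qed.

Lemma word_opL i w X : ell (s i * w)%g = (ell w).+1 -> T i (word_op w X) = word_op (s i * w)%g X.
Proof.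
have [sw wE] := rwordP WD w; have [sw' wE'] := rwordP WD (s i * w)%g.
move=> E; apply: (@matsumoto (i :: rword s w)); last by rewrite word_prod_cons wE wE'.
  by rewrite /reduced word_prod_cons wE E /= sw.
exact: reduced_rword.
Qed.

Lemma word_opR i w X : ell (w * s i)%g = (ell w).+1 -> word_op w (T i X) = word_op (w * s i)%g X.
Proof.
have [sw wE] := rwordP WD w; have [sw' wE'] := rwordP WD (w * s i)%g.
rewrite /word_op -foldr_rcons => E; apply: matsumoto; last by rewrite word_prod_rcons wE wE'.
  by rewrite /reduced word_prod_rcons wE E size_rcons sw.
exact: reduced_rword.
Qed.

End Operators.

(** Inverting an operator word reverses it, and the reversal of an alternating word is itself or its
    partner according to the parity of m. *)
Lemma inverse_braid (V : Type) (T T' : 'I_n -> V -> V) :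
    (forall i, cancel (T i) (T' i)) -> (forall i, cancel (T' i) (T i)) ->
  satisfies_braid T -> satisfies_braid T'.
Proof.
move=> TK T'K braid i j m X ij mP.
have foldK' u Y : foldr T (foldr T' Y (rev u)) u = Y.
  by elim: u Y => //= k u IH Y; rewrite rev_cons foldr_rcons IH T'K.
have foldK u Y : foldr T' (foldr T Y u) (rev u) = Y.
  by elim: u Y => //= k u IH Y; rewrite rev_cons foldr_rcons TK IH.
have E : foldr T' X (rev (alt_word i j m)) = foldr T' X (rev (alt_word j i m)).
  by rewrite -[RHS](foldK (alt_word i j m)) (braid _ _ _ _ ij mP) foldK'.
by move: E; rewrite !rev_alt_word; case: (odd m).
Qed.

End Matsumoto.

(** * Kazhdan-Lusztig polynomials *)

Section KazhdanLusztig.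
Variables (n : nat) (A : 'M[int]_n) (gT : finGroupType)
  (s : 'I_n -> gT) (lact : gT -> lat n -> lat n).
Hypothesis WD : weyl_datum A s lact.

Local Notation ell := (ell s).
Local Notation bruhat := (bruhat s).
Local Notation KL := (KL s).

Lemma bruhat1 x : bruhat x 1%g = (x == 1%g).
Proof.
apply/idP/eqP => [|->]; last exact: bruhat_refl.
by case/bruhat_ell => //; rewrite (ell1 s).
Qed.

(** Every recursive call has as upper element one that is shorter than w. *)
Lemma KLr_fuel k k' x w : (ell w <= k)%N -> (ell w <= k')%N -> KLr s k x w = KLr s k' x w.
Proof.
wlog kk' : k k' / (k <= k')%N => [H wk wk'|].
  by case: (leqP k k') => [/H|/ltnW/H H']; [exact|symmetry; exact: H'].
elim: k k' kk' x w => [|k IH] k' kk' x w wk wk'.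
  have /(ell_eq0 WD) w1 : ell w = 0%N by apply/eqP; rewrite -leqn0.
  by case: k' kk' wk' => // k' _ _; rewrite w1 /= bruhat1 eqxx andbT; case: eqP.
case: k' kk' wk' => // k' kk' wk' /=.
case: ifP => // bw; case: ifP => // w1; case: pickP => // i iw.
have sw : (ell (s i * w)%g <= k)%N by rewrite -ltnS (leq_trans iw).
have sw' : (ell (s i * w)%g <= k')%N by rewrite -ltnS (leq_trans iw).
rewrite !(IH k' _ _ (s i * w)%g) //; congr (_ - _); apply: eq_bigr => z /and3P [zw _ _].
have zk := leq_trans (bruhat_ell_le zw) sw; have zk' := leq_trans (bruhat_ell_le zw) sw'.
by rewrite (IH k' kk' x z) // (IH k' kk' z (s i * w)%g).
Qed.

Definition KLmu (z v : gT) : int :=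
  if odd (ell v - ell z) then (KL z v)`_((ell v - ell z).-1./2) else 0.

Definition KL_recursion (w : gT) (i : 'I_n) : Prop := forall x,
  KL x w = if ~~ bruhat x w then 0 else
    let v := (s i * w)%g in let c : nat := (ell (s i * x)%g < ell x)%N in
    'X^(1 - c)%N * KL (s i * x)%g v + 'X^c * KL x v
      - \sum_(z | [&& bruhat z v, z != v & (ell (s i * z)%g < ell z)%N])
           (KLmu z v)%:P * 'X^((ell w - ell z)./2)%N * KL x z.

(** The descent is the one chosen by [pick] inside [KLr], so it is handed out existentially and the
    inductions below follow it. *)
Lemma KL_rec w : w != 1%g ->
  exists2 i, (ell (s i * w)%g < ell w)%N & KL_recursion w i.
Proof.
move=> w1; rewrite /KL_recursion /Defs.KL; have [j jw] := descent_exists WD w1.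
case Ek : (ell w) => [|k]; first by rewrite Ek in jw.
rewrite /= (negPf w1); case: pickP => [i iw|/(_ j)]; last by rewrite jw.
have sw : (ell (s i * w)%g <= k)%N by rewrite -ltnS -Ek.
exists i; first by rewrite -Ek.
move=> x; case: ifP => // bw.
rewrite !(KLr_fuel (k := k) _ sw (leqnn _)); congr (_ - _).
apply: eq_bigr => z /and3P [zw _ _]; have zk := leq_trans (bruhat_ell_le zw) sw.
by rewrite (KLr_fuel _ zk (leqnn _)) (KLr_fuel _ sw (leqnn _)) Ek.
Qed.

Lemma KL_nbruhat x w : ~~ bruhat x w -> KL x w = 0.
Proof.
move=> nb; have [w1|w1] := eqVneq w 1%g.
  by move: nb; rewrite w1 bruhat1 /Defs.KL (ell1 s) /= => /negPf ->.
by have [i _ ->] := KL_rec w1; rewrite nb.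
Qed.

Lemma KL11 : KL 1%g 1%g = 1.
Proof. by rewrite /Defs.KL (ell1 s) /= eqxx. Qed.

Lemma nbruhat_lt x w : (ell w < ell x)%N -> ~~ bruhat x w.
Proof. by rewrite ltnNge; apply: contra => /bruhat_ell_le. Qed.

(* The second clause is the bound [deg P_{x,w} <= (l(w) - l(x) - 1)/2]. *)
Lemma KL_deg w : KL w w = 1 /\
  forall x k, x != w -> (ell w <= ell x + k.*2)%N -> (KL x w)`_k = 0.
Proof.
move El : (ell w) => l; elim/ltn_ind: l w El => l IH w El.
have [w1|w1] := eqVneq w 1%g.
  rewrite w1 KL11; split=> // x k x1 _.
  by rewrite KL_nbruhat ?coef0 // bruhat1.
have [i iw KLE] := KL_rec w1; set v := (s i * w)%g in iw KLE.
have Ev : ell w = (ell v).+1 by case: (ell_sl WD w i) => -[]; rewrite -/v; lia.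
have wv : w = (s i * v)%g by rewrite /v (sK WD).
have IHv := IH (ell v) ltac:(lia) v erefl.
have IHz z : bruhat z v -> KL z z = 1 /\
    forall x k, x != z -> (ell z <= ell x + k.*2)%N -> (KL x z)`_k = 0.
  by move=> /bruhat_ell_le zv; apply: (IH (ell z)) => //; lia.
split=> [|x k xw lk].
  rewrite KLE bruhat_refl /= -/v iw expr0 mul1r IHv.1 KL_nbruhat ?mulr0 ?addr0; last first.
    by apply: nbruhat_lt; lia.
  rewrite big1 ?subr0 // => z /and3P [zv _ _]; rewrite [KL w z]KL_nbruhat ?mulr0 //.
  by apply: nbruhat_lt; have := bruhat_ell_le zv; lia.
have [bx|nbx] := boolP (bruhat x w); last by rewrite KL_nbruhat ?coef0.
have lx : (ell x < ell w)%N by case: (bruhat_ell bx) => // E; rewrite E eqxx in xw.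
have sumE z : [&& bruhat z v, z != v & (ell (s i * z)%g < ell z)%N] -> z != x ->
    ((KLmu z v)%:P * 'X^((ell w - ell z)./2)%N * KL x z)`_k = 0.
  move=> /and3P [zv zv' sz] zx; rewrite /KLmu; case: ifP => [od|]; last by rewrite !mul0r coef0.
  rewrite -mulrA coefCM coefXnM; case: ltnP => ek; first by rewrite mulr0.
  have zl := bruhat_ell_le zv.
  have odw : ~~ odd (ell w - ell z) by rewrite Ev subSn //= od.
  rewrite (IHz z zv).2 ?mulr0 // 1?eq_sym //.
  have := odd_double_half (ell w - ell z); rewrite (negPf odw).
  by move: ek lk; rewrite -El; lia.
rewrite KLE bx coefB coefD coef_sum -/v.
have sxw : (s i * x)%g = v -> x = w by move=> E; rewrite wv -E (sK WD).
case: (ell_sl WD x i) => [[lsx _]|[lsx _]].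
  have -> : (ell (s i * x)%g < ell x)%N = false by lia.
  rewrite big1 => [|z zP]; last first.
    apply: sumE => //; apply/eqP => zx; move: zP => /and3P [_ _].
    by rewrite zx; lia.
  rewrite subr0 subn0 expr1 coefXM expr0 mul1r.
  have xv0 : (KL x v)`_k = 0.
    have [E|xv] := eqVneq x v; last by apply: IHv.2 => //; lia.
    have k0 : (0 < k)%N by move: lk; rewrite -El E; lia.
    by rewrite E IHv.1 coef1; case: k k0 {lk sumE}.
  rewrite xv0 addr0; case: eqP => // k0; apply: IHv.2; last by lia.
  by apply/eqP => /sxw E; rewrite E eqxx in xw.
have -> : (ell (s i * x)%g < ell x)%N = true by lia.
rewrite subnn expr0 mul1r expr1 coefXM.
have -> : (KL (s i * x)%g v)`_k = 0.
  by apply: IHv.2; [apply/eqP => /sxw E; rewrite E eqxx in xw|lia].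
rewrite add0r; have k0 : k != 0%N by apply/eqP; lia.
have xv : x != v by apply/eqP => E; move: lsx; rewrite E -wv; lia.
rewrite (negPf k0).
have [bxv|nbxv] := boolP (bruhat x v); last first.
  rewrite KL_nbruhat // coef0 big1 ?subr0 // => z zP; apply: sumE => //.
  by apply: contra nbxv => /eqP <-; case/and3P: zP.
(* The summand z = x cancels the only coefficient of q P_{x,v} that could break the bound: at k =
   (ell w - ell x)/2 both are [KLmu x v]. *)
rewrite (bigD1 x) /=; last by rewrite bxv xv; lia.
rewrite big1 ?addr0 => [|z /andP [zP zx]]; last exact: sumE.
rewrite (IHz x bxv).1 mulr1 coefCM coefXn /KLmu.
have lxv : (ell x < ell v)%N by case: (bruhat_ell bxv) => // E; rewrite E eqxx in xv.
have hd := odd_double_half (ell v - ell x).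
have hw := odd_double_half (ell w - ell x).
case: ifP => od; last first.
  rewrite mul0r subr0; apply: IHv.2 => //.
  by move: lk; rewrite -El; move: hd; rewrite od; lia.
have [Ek|kn] := eqVneq k ((ell w - ell x)./2).
  rewrite mulr1; apply/eqP; rewrite subr_eq0; apply/eqP; congr (_`__).
  move: hw hd; rewrite Ek od Ev subSn ?(ltnW lxv) //= od /=; lia.
rewrite mulr0 subr0; apply: IHv.2 => //.
by move: kn hw hd; rewrite od; rewrite Ev subSn ?(ltnW lxv) //= od /=; move: lk; rewrite -El; lia.
Qed.

End KazhdanLusztig.

(** * Kazhdan-Lusztig elements *)

Notation zeval q p := (map_poly intr p).[q].

Section HeckeModule.
Variables (n : nat) (A : 'M[int]_n) (gT : finGroupType)
  (s : 'I_n -> gT) (lact : gT -> lat n -> lat n).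
Hypothesis WD : weyl_datum A s lact.
Variables (K : fieldType) (V : lmodType K).

Local Notation ell := (ell s).
Local Notation bruhat := (bruhat s).
Local Notation KL := (KL s).
Local Notation w0 := (w0 s).
Local Notation Tw := (word_op s).

(** The operators of interest twist scalars by the Weyl group, so linearity is demanded only for
    those scalars that they commute with. *)
Definition op_scalar (T : 'I_n -> V -> V) (k : K) :=
  forall i X, T i (k *: X) = k *: T i X.

Definition hecke_action (q : K) (T : 'I_n -> V -> V) :=
  [/\ q != 0, forall i X Y, T i (X + Y) = T i X + T i Y, op_scalar T q,
      forall i X, T i (T i X) = X + (q^-1 - q) *: T i X
    & satisfies_braid A T].

Definition KLval (q : K) (x w : gT) : K :=
  q ^+ ell w / q ^+ ell x * zeval (q ^- 2) (KL x w).

Definition KLelt (q : K) (T : 'I_n -> V -> V) (w : gT) (X : V) : V :=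
  \sum_x KLval q x w *: Tw T x X.

Lemma zeval_intr (z : int) (q : K) : zeval q z%:P = z%:~R.
Proof. by rewrite map_polyC hornerC. Qed.

Section Action.
Variables (q : K) (T : 'I_n -> V -> V).
Hypothesis HT : hecke_action q T.

Let q0 : q != 0. Proof. by case: HT. Qed.
Let TD i X Y : T i (X + Y) = T i X + T i Y. Proof. by case: HT. Qed.
Let quad i X : T i (T i X) = X + (q^-1 - q) *: T i X. Proof. by case: HT. Qed.
Let braid : satisfies_braid A T. Proof. by case: HT. Qed.

Lemma op_scalar1 : op_scalar T 1. Proof. by move=> i X; rewrite !scale1r. Qed.

Lemma op_scalarM k k' : op_scalar T k -> op_scalar T k' -> op_scalar T (k * k').
Proof. by move=> ck ck' i X; rewrite -scalerA ck ck' scalerA. Qed.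

Lemma op_scalarX k e : op_scalar T k -> op_scalar T (k ^+ e).
Proof.
move=> ck; elim: e => [|e IH]; first exact: op_scalar1.
by rewrite exprS; apply: op_scalarM.
Qed.

Lemma op0 i : T i 0 = 0.
Proof. by apply: (addrI (T i 0)); rewrite -TD !addr0. Qed.

Lemma opN i X : T i (- X) = - T i X.
Proof. by apply: (addrI (T i X)); rewrite -TD !subrr op0. Qed.

Lemma op_scalarD k k' : op_scalar T k -> op_scalar T k' -> op_scalar T (k + k').
Proof. by move=> ck ck' i X; rewrite !scalerDl TD ck ck'. Qed.

Lemma op_scalarN k : op_scalar T k -> op_scalar T (- k).
Proof. by move=> ck i X; rewrite !scaleNr opN ck. Qed.

Lemma op_scalar0 : op_scalar T 0.
Proof. by move=> i X; rewrite !scale0r op0. Qed.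

Lemma op_scalarV k : op_scalar T k -> op_scalar T k^-1.
Proof.
have [->|k0] := eqVneq k 0; first by rewrite invr0.
move=> ck i X; apply: (scalerI k0); rewrite -ck !scalerA mulfV //.
by rewrite !scale1r.
Qed.

Lemma op_scalar_int (z : int) : op_scalar T z%:~R.
Proof.
suff nn (e : nat) : op_scalar T e%:R.
  by case: z => e; [exact: nn | rewrite NegzE mulrNz; apply/op_scalarN/nn].
elim: e => [|e IH]; first exact: op_scalar0.
by rewrite -natr1; apply: op_scalarD => //; apply: op_scalar1.
Qed.

Lemma op_scalar_zeval k (p : {poly int}) : op_scalar T k -> op_scalar T (zeval k p).
Proof.
move=> ck; elim/poly_ind: p => [|p z IH]; first by rewrite rmorph0 horner0; apply: op_scalar0.
rewrite rmorphD rmorphM /= map_polyX map_polyC hornerMXaddC.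
by apply: op_scalarD; [apply: op_scalarM | apply: op_scalar_int].
Qed.

Lemma op_scalar_KLval x w : op_scalar T (KLval q x w).
Proof.
have qs : op_scalar T q by case: HT.
apply: op_scalarM; first apply: op_scalarM.
- exact: op_scalarX.
- by apply/op_scalarV/op_scalarX.
- by apply/op_scalar_zeval/op_scalarV/op_scalarX.
Qed.

Lemma op_sum i (I : Type) (r : seq I) (P : pred I) F :
  T i (\sum_(x <- r | P x) F x) = \sum_(x <- r | P x) T i (F x).
Proof. by apply: (big_morph (T i) (TD i) (op0 i)). Qed.

Lemma word_op_sum w (I : Type) (r : seq I) (P : pred I) F :
  Tw T w (\sum_(x <- r | P x) F x) = \sum_(x <- r | P x) Tw T w (F x).
Proof. by rewrite /word_op; elim: (rword s w) => //= i u ->; rewrite op_sum. Qed.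

Lemma word_opZ w k X : op_scalar T k -> Tw T w (k *: X) = k *: Tw T w X.
Proof. by move=> ck; rewrite /word_op; elim: (rword s w) => //= i u ->; rewrite ck. Qed.

Lemma word_opB w X Y : Tw T w (X - Y) = Tw T w X - Tw T w Y.
Proof. by rewrite /word_op; elim: (rword s w) => //= i u ->; rewrite TD opN. Qed.

Lemma op_word_op i x X : T i (Tw T x X) = Tw T (s i * x)%g X
  + (if (ell (s i * x)%g < ell x)%N then (q^-1 - q) *: Tw T x X else 0).
Proof.
case: (ell_sl WD x i) => [[E _]|[E _]].
  by rewrite (word_opL WD braid X E) E ltnNge leqnSn addr0.
have Ex : ell (s i * (s i * x))%g = (ell (s i * x)%g).+1 by rewrite (sK WD).
have := word_opL WD braid X Ex; rewrite (sK WD) => TE.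
by rewrite -TE quad TE E leqnn.
Qed.

(** In the normalisation q^(l(w)-l(x)) P(q^-2) the powers of the recursion collapse to a factor q or
    q^-1, and the shifts in the sum disappear. *)
Lemma KLval_rec w i : (ell (s i * w)%g < ell w)%N -> KL_recursion s w i ->
  forall x, KLval q x w = KLval q (s i * x)%g (s i * w)%g
    + (if (ell (s i * x)%g < ell x)%N then q^-1 else q) * KLval q x (s i * w)%g
    - \sum_(z | [&& bruhat z (s i * w)%g, z != (s i * w)%g & (ell (s i * z)%g < ell z)%N])
        (KLmu s z (s i * w)%g)%:~R * KLval q x z.
Proof.
move=> iw; rewrite /KL_recursion => KLE x; set v := (s i * w)%g in iw KLE *.
have wv : w = (s i * v)%g by rewrite /v (sK WD).
have Ev : ell w = (ell v).+1 by case: (ell_sl WD w i) => -[]; rewrite -/v; lia.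
have vw : bruhat v w by rewrite wv; apply: (@bruhat_up _ _ s i v); rewrite -wv.
(* If x is not below w the left side vanishes by the guard; the lifting property and transitivity
   kill every term on the right. *)
rewrite /KLval KLE; case: ifP => [nbx|/negbFE bx].
  have Z y : ~~ bruhat y w -> forall z, bruhat z v -> KL y z = 0.
    move=> nb z zv; apply: (KL_nbruhat WD); apply: contra nb => yz.
    by apply: bruhat_trans (bruhat_trans yz zv) vw.
  rewrite (KL_nbruhat WD (x := (s i * x)%g)); last first.
    by apply: contra nbx => /(bruhat_lift WD); rewrite -wv; apply.
  rewrite (Z x) ?bruhat_refl // rmorph0 horner0 !mulr0 add0r big1 ?subr0 //.
  by move=> z /and3P [zv _ _]; rewrite (Z x) // rmorph0 horner0 !mulr0.
have Q0 e : q ^+ e != 0 by rewrite expf_neq0.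
rewrite rmorphB rmorphD !rmorphM /= !map_polyXn hornerD hornerN hornerD !hornerM !hornerXn.
rewrite mulrBr mulrDr rmorph_sum horner_sum /= mulr_sumr; congr (_ - _).
  rewrite Ev; case: (ell_sl WD x i) => [[lsx _]|[lsx _]].
    rewrite lsx ltnNge leqnSn /= subn0 expr1 expr0 mul1r !exprS.
    by congr (_ + _); field; rewrite ?q0 ?Q0.
  rewrite lsx leqnn subnn expr1 expr0 mul1r !exprS.
  by congr (_ + _); field; rewrite ?q0 ?Q0.
apply: eq_bigr => z /and3P [zv _ _]; rewrite !rmorphM /= map_polyXn !hornerM hornerXn.
rewrite zeval_intr /KLmu; case: ifP => od; last by rewrite !mul0r mulr0.
have zl := bruhat_ell_le zv.
have odw : odd (ell w - ell z) = false by rewrite Ev subSn //= od.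
have hw := odd_double_half (ell w - ell z); rewrite odw add0n in hw.
have -> : ell w = (ell z + (ell w - ell z)./2.*2)%N by rewrite hw; lia.
rewrite addKn doubleK -muln2 mulnC exprD exprM exprVn.
by field; rewrite ?Q0 ?expf_neq0.
Qed.

(** The Kazhdan-Lusztig product formula; [T i + q] is the element attached to s_i. *)
Lemma KLelt_rec w i X : (ell (s i * w)%g < ell w)%N -> KL_recursion s w i ->
  KLelt q T w X = T i (KLelt q T (s i * w)%g X) + q *: KLelt q T (s i * w)%g X
    - \sum_(z | [&& bruhat z (s i * w)%g, z != (s i * w)%g & (ell (s i * z)%g < ell z)%N])
        (KLmu s z (s i * w)%g)%:~R *: KLelt q T z X.
Proof.
move=> iw KLE; rewrite {1}/KLelt; under eq_bigr do rewrite (KLval_rec iw KLE) scalerBl scalerDl.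
set v := (s i * w)%g; rewrite sumrB; congr (_ - _); last first.
  under eq_bigr do rewrite scaler_suml.
  rewrite exchange_big /=; apply: eq_bigr => z _; rewrite /KLelt scaler_sumr.
  by apply: eq_bigr => x _; rewrite scalerA.
rewrite big_split /= /KLelt op_sum.
under [in RHS]eq_bigr do rewrite op_scalar_KLval op_word_op scalerDr.
rewrite big_split /= -addrA; congr (_ + _).
  rewrite [RHS](reindex_inj (mulgI (s i))) /=; apply: eq_bigr => x _.
  by rewrite (sK WD).
rewrite scaler_sumr -big_split; apply: eq_bigr => x _ /=.
case: ifP => _; last by rewrite scaler0 add0r scalerA.
by rewrite !scalerA -scalerDl; congr (_ *: _); ring.
Qed.

Lemma KLelt1 X : KLelt q T 1%g X = X.
Proof.
rewrite /KLelt (bigD1 1%g) //= big1 => [|x x1].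
  by rewrite /KLval (KL11 s) rmorph1 hornerC mulr1 divff ?expf_neq0 // scale1r (word_op1 WD) addr0.
by rewrite /KLval (KL_nbruhat WD) ?bruhat1 // rmorph0 horner0 mulr0 scale0r.
Qed.

End Action.

(** By [KLelt_rec] these elements depend on q and T only through the operators T_i + q and the
    integers [KLmu]. Bar-invariance is the case of q^-1 with the inverse operators. *)
Lemma KLelt_bar q q' T T' w X : hecke_action q T -> hecke_action q' T' ->
    (forall i Y, T i Y + q *: Y = T' i Y + q' *: Y) ->
  KLelt q T w X = KLelt q' T' w X.
Proof.
move=> HT HT' TT'; move El : (ell w) => l; elim/ltn_ind: l w El => l IH w El.
have [->|w1] := eqVneq w 1%g; first by rewrite !KLelt1.
have [i iw KLE] := KL_rec WD w1.
rewrite (KLelt_rec HT X iw KLE) (KLelt_rec HT' X iw KLE) TT'.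
have lv : (ell (s i * w)%g < l)%N by rewrite -El.
rewrite (IH _ lv _ erefl); congr (_ - _); apply: eq_bigr => z /and3P [zv _ _].
by rewrite (IH _ (leq_ltn_trans (bruhat_ell_le zv) lv) _ erefl).
Qed.

(** For d = q^-1 - q this is the inverse of T_i, by the quadratic relation. *)
Definition inverse_op (T : 'I_n -> V -> V) (d : K) (i : 'I_n) (X : V) : V :=
  T i X - d *: X.

Section Inverse.
Variables (q : K) (T : 'I_n -> V -> V).
Hypothesis HT : hecke_action q T.
Let T' := inverse_op T (q^-1 - q).

Lemma op_scalar_inverse k : op_scalar T k -> op_scalar T' k.
Proof.
by move=> ck i X; rewrite /T' /inverse_op ck scalerBr !scalerA [_ * k]mulrC.
Qed.

Lemma op_scalar_diff : op_scalar T (q^-1 - q).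
Proof.
have qs : op_scalar T q by case: HT.
by apply: (op_scalarD HT); [apply: op_scalarV|apply: (op_scalarN HT)].
Qed.

Lemma inverse_opK i : cancel (T' i) (T i).
Proof.
case: (HT) => q0 TD qs quad _ X; rewrite /T' /inverse_op TD (opN HT).
by rewrite op_scalar_diff quad addrK.
Qed.

Lemma inverse_opVK i : cancel (T i) (T' i).
Proof. by case: (HT) => q0 TD qs quad _ X; rewrite /T' /inverse_op quad addrK. Qed.

Lemma hecke_action_inverse : hecke_action q^-1 T'.
Proof.
case: (HT) => q0 TD qs quad braid; split.
- by rewrite invr_eq0.
- by move=> i X Y; rewrite /T' /inverse_op TD scalerDr opprD addrACA.
- exact/op_scalar_inverse/op_scalarV.
- move=> i X; rewrite {1}/T' /inverse_op inverse_opK invrK -scaleNr opprB.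
  by rewrite -/T'.
- exact: (inverse_braid inverse_opVK inverse_opK braid).
Qed.

End Inverse.

Section Functional.
Variables (q : K) (T T' : 'I_n -> V -> V) (d : K).
Hypotheses (HT : hecke_action q T) (cd : op_scalar T d)
  (braid' : satisfies_braid A T')
  (TE : forall i X, T' i X = T i X - d *: X) (TK : forall i, cancel (T' i) (T i)).
Variables (phi : V -> K) (kappa : K) (X : V).
Hypotheses (phiB : forall Y Z, phi (Y - Z) = phi Y - phi Z)
  (phiZ : forall k Y, phi (k *: Y) = k * phi Y)
  (phiT : forall x, phi (Tw T x X) = (x == w0)%:R * kappa).

(** Peel a left descent s_i off y. If x s_i < x, the inverse operator cancels a letter of T_x.
    Otherwise an extra term -d T_x appears; it could contribute only if x y' = w0, and then x s_i =
    w0 y^-1 would be shorter than x. *)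
Lemma phi_inverse_op x y : phi (Tw T x (Tw T' y X)) = (x * y == w0)%g%:R * kappa.
Proof.
have braid : satisfies_braid A T by case: HT.
move El : (ell y) => l; elim: l x y El => [|l IH] x y El.
  by rewrite (ell_eq0 WD El) (word_op1 WD) mulg1 phiT.
have y1 : y != 1%g by apply/eqP => y1; rewrite y1 (ell1 s) in El.
have [i iy] := descent_exists WD y1; set y' := (s i * y)%g in iy.
have Ey' : ell y' = l by case: (ell_sl WD y i) => -[]; rewrite -/y'; lia.
have Ey : y = (s i * y')%g by rewrite /y' (sK WD).
have Ly : ell (s i * y')%g = (ell y').+1 by rewrite -Ey El Ey'.
clearbody y'; rewrite Ey -(word_opL WD braid' X Ly) mulgA.
case: (ell_sr WD x i) => [[lx _]|[lx _]].
  rewrite TE (word_opB HT) (word_opZ _ _ cd) (word_opR WD braid _ lx) phiB phiZ !(IH _ _ Ey').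
  suff -> : (x * y' == w0)%g = false by rewrite mul0r mulr0 subr0.
  apply/eqP => xy; have Ex : x = (w0 * y'^-1)%g by rewrite -xy mulgK.
  have Exs : (x * s i)%g = (w0 * y^-1)%g by rewrite Ex Ey invMg (sV WD) mulgA.
  have := ell_w0M WD y^-1%g; have := ell_w0M WD y'^-1%g.
  by rewrite -Ex -Exs !(ellV WD) lx El Ey'; lia.
have Lx : ell (x * s i * s i)%g = (ell (x * s i)%g).+1 by rewrite (Ks WD).
have := word_opR WD braid (T' i (Tw T' y' X)) Lx; rewrite (Ks WD) TK => <-.
exact: IH.
Qed.

End Functional.

End HeckeModule.

(** * Reciprocal polynomials and the constant term of the product *)

Lemma zeval_sum (K : fieldType) (q : K) (p : {poly int}) :
  zeval q p = \sum_(k < size p) (p`_k)%:~R * q ^+ k.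
Proof.
rewrite -{1}[p]coefK poly_def rmorph_sum horner_sum; apply: eq_bigr => k _ /=.
by rewrite map_polyZ map_polyXn hornerZ hornerXn.
Qed.

Lemma zeval_reciprocal (K : fieldType) (t : K) (p : {poly int}) : t != 0 ->
    (forall r : {poly int}, zeval t r = 0 -> r = 0) ->
  zeval t p = zeval t^-1 p -> zeval t p = (p.[0])%:~R.
Proof.
move=> t0 trans tp; set d := size p.
(* This is X^d (p(X) - p(X^-1)), with d large enough to clear the negative powers. For k > 0 its
   coefficient at d + k is that of p at k. *)
pose r := \sum_(k < d) (p`_k)%:P * ('X^(d + k) - 'X^(d - k)) : {poly int}.
have r0 : r = 0.
  apply: trans; have : t ^+ d * (zeval t p - zeval t^-1 p) = 0 by rewrite tp subrr mulr0.
  rewrite /r rmorph_sum horner_sum !zeval_sum -sumrB mulr_sumr => E; rewrite -[RHS]E.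
  apply: eq_bigr => k _; rewrite rmorphM rmorphB /= !map_polyXn hornerM hornerD hornerN !hornerXn.
  rewrite zeval_intr -mulrBr mulrCA; congr (_ * _); rewrite mulrBr exprD exprVn.
  congr (_ - _); apply: (mulIf (expf_neq0 k t0)); rewrite -exprD subnK ?(ltnW (ltn_ord k)) //.
  by rewrite divfK ?expf_neq0.
have pk k : (0 < k)%N -> p`_k = 0.
  move=> k0; have [kd|kd] := ltnP k d; last by rewrite nth_default.
  have : r`_(d + k) = 0 by rewrite r0 coef0.
  rewrite /r coef_sum (bigD1 (Ordinal kd)) //= big1 => [|j jk].
    rewrite coefCM coefB !coefXn eqxx.
    have -> : ((d + k)%N == (d - k)%N) = false by apply/eqP; lia.
    by rewrite subr0 mulr1.
  rewrite coefCM coefB !coefXn eqn_add2l.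
  have -> : (k == j) = false by apply/eqP => E; move: jk; rewrite -val_eqE /= -E eqxx.
  have -> : ((d + k)%N == (d - j)%N) = false by apply/eqP; lia.
  by rewrite subrr mulr0.
rewrite -[p in LHS](_ : (p.[0])%:P = p) ?zeval_intr //.
apply/polyP => k; rewrite coefC horner_coef0; case: eqP => [->//|/eqP k0].
by rewrite pk // lt0n.
Qed.

Section KLPolynomial.
Variables (n : nat) (A : 'M[int]_n) (gT : finGroupType)
  (s : 'I_n -> gT) (lact : gT -> lat n -> lat n).
Hypothesis WD : weyl_datum A s lact.
Local Notation ell := (ell s).
Local Notation KL := (KL s).

(* [X^(l(w) - l(x)) P_{x,w}(X^-2)]; the truncated subtraction is harmless, since
   the exponent is nonnegative whenever the coefficient is nonzero. *)
Definition KLpoly (x w : gT) : {poly int} :=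
  \sum_(k < size (KL x w)) (KL x w)`_k *: 'X^(ell w - ell x - k.*2).

Lemma KL_coef_neq0 x w k : (KL x w)`_k != 0 ->
  (x = w /\ k = 0%N) \/ (ell x + k.*2 < ell w)%N.
Proof.
have [deg1 deg] := KL_deg WD w.
have [->|xw] := eqVneq x w.
  by rewrite deg1 coef1; case: k => [_|k] /=; [left|].
by rewrite ltnNge => nz; right; apply: contra nz => /(deg _ _ xw) ->.
Qed.

Lemma zeval_KLpoly (K : fieldType) (q : K) x w : q != 0 ->
  zeval q (KLpoly x w) = KLval s q x w.
Proof.
move=> q0; rewrite /KLval [in RHS]zeval_sum mulr_sumr /KLpoly rmorph_sum horner_sum.
apply: eq_bigr => k _ /=; rewrite map_polyZ map_polyXn hornerZ hornerXn mulrCA.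
have [->|/KL_coef_neq0 nz] := eqVneq ((KL x w)`_k) 0; first by rewrite !mul0r.
congr (_ * _); have Q0 e : q ^+ e != 0 by rewrite expf_neq0.
have le : (ell x + k.*2 <= ell w)%N by case: nz => [[E ->]|/ltnW //]; rewrite -E addn0.
rewrite -subnDA -{2}(subnK le) !exprD exprVn -exprM mul2n.
by field; rewrite !Q0.
Qed.

(** For x different from w the degree bound is strict, so every surviving exponent of X is
    positive. *)
Lemma KLpoly_at0 x w : (KLpoly x w).[0] = (x == w)%:R.
Proof.
rewrite /KLpoly horner_sum; have [->|xw] := eqVneq x w.
  rewrite (KL_deg WD w).1 size_poly1 big_ord1 coef1 hornerZ hornerXn /=.
  by rewrite subnn expr0 mulr1.
rewrite big1 // => k _; rewrite hornerZ hornerXn.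
have [->|/KL_coef_neq0 [[E _]|lt]] := eqVneq ((KL x w)`_k) 0; first by rewrite mul0r.
  by rewrite E eqxx in xw.
by rewrite expr0n -subnDA subn_eq0 leqNgt lt mulr0.
Qed.

Variables (K : fieldType) (t : K) (V : lmodType K) (T : 'I_n -> V -> V).
Hypotheses (HT : hecke_action A t T)
  (trans : forall r : {poly int}, zeval t r = 0 -> r = 0).
Variables (phi : V -> K) (kappa : K) (X : V).
Hypotheses (phiD : forall Y Z, phi (Y + Z) = phi Y + phi Z)
  (phiZ : forall k Y, phi (k *: Y) = k * phi Y) (kappa0 : kappa != 0)
  (phiT : forall x, phi (word_op s T x X) = (x == w0 s)%:R * kappa)
  (phiT' : forall x, phi (word_op s (inverse_op T (t^-1 - t)) x X) = (x == w0 s)%:R * kappa).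

Let phi_sum (I : Type) (r : seq I) (P : pred I) F :
  phi (\sum_(x <- r | P x) F x) = \sum_(x <- r | P x) phi (F x).
Proof.
have phi0 : phi 0 = 0 by apply: (addrI (phi 0)); rewrite -phiD !addr0.
exact: (big_morph phi phiD phi0).
Qed.

Let phiB Y Z : phi (Y - Z) = phi Y - phi Z.
Proof. by rewrite phiD -scaleN1r phiZ mulN1r. Qed.

(** The second factor is taken at -X because the two expansions multiplied in [phi_KLelt] have
    parameters q and -q. *)
Definition inversion_poly (w u : gT) : {poly int} :=
  \sum_x KLpoly x w * (KLpoly (x^-1 * w0 s)%g u \Po - 'X).

Lemma zeval_compN (q : K) (p : {poly int}) : zeval q (p \Po - 'X) = zeval (- q) p.
Proof. by rewrite map_comp_poly rmorphN /= map_polyX horner_comp hornerN hornerX. Qed.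

Lemma phi_KLelt q (T1 T2 : 'I_n -> V -> V) w u : hecke_action A q T1 ->
    q != 0 -> (forall k, op_scalar T2 k -> op_scalar T1 k) -> hecke_action A (- q) T2 ->
    (forall x y, phi (word_op s T1 x (word_op s T2 y X)) = (x * y == w0 s)%g%:R * kappa) ->
  phi (KLelt s q T1 w (KLelt s (- q) T2 u X)) = zeval q (inversion_poly w u) * kappa.
Proof.
move=> H1 q0 sc H2 phiTT.
rewrite /KLelt phi_sum /inversion_poly rmorph_sum horner_sum mulr_suml.
apply: eq_bigr => x _ /=.
rewrite phiZ (word_op_sum s H1) phi_sum rmorphM hornerM /= zeval_compN.
rewrite !zeval_KLpoly ?oppr_eq0 // -[RHS]mulrA; congr (_ * _).
rewrite (bigD1 (x^-1 * w0 s)%g) //= (word_opZ s _ _ (sc _ (op_scalar_KLval s H2 _ _))).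
rewrite phiZ phiTT mulKVg eqxx mul1r big1 ?addr0 // => y yx.
rewrite (word_opZ s _ _ (sc _ (op_scalar_KLval s H2 _ _))) phiZ phiTT.
suff -> : (x * y == w0 s)%g = false by rewrite mul0r mulr0.
by apply/eqP => xy; move: yx; rewrite -xy mulKg eqxx.
Qed.

(** The substitution exchanges the roots q^-1 and -q of the quadratic relation. It is what brings
    [gammat] into the same family as [gamma]. *)
Lemma hecke_action_oppV (q : K) (T1 : 'I_n -> V -> V) :
  hecke_action A q T1 -> hecke_action A (- q^-1) T1.
Proof.
move=> H1; case: (H1) => q0 TD qs quad braid; split=> //.
- by rewrite oppr_eq0 invr_eq0.
- exact/(op_scalarN H1)/op_scalarV.
- by move=> i Y; rewrite quad invrN invrK opprK; congr (_ + _ *: _); rewrite addrC.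
Qed.

(* Both factors being bar-invariant, the left-hand side is [N(t) = N(t^-1)] for
   the integer polynomial [N = inversion_poly w u], so only [N(0)] remains. *)
Lemma phi_KLelt_oppV w u :
  phi (KLelt s t T w (KLelt s (- t^-1) T u X)) = (w * u == w0 s)%g%:R * kappa.
Proof.
have t0 : t != 0 by case: HT.
have ts : op_scalar T t by case: HT.
pose d := t^-1 - t; pose T' := inverse_op T d.
have HT' : hecke_action A t^-1 T' := hecke_action_inverse HT.
have HTn := hecke_action_oppV HT.
have HTn' : hecke_action A (- t) T' by have := hecke_action_oppV HT'; rewrite invrK.
have barT v Y : KLelt s t T v Y = KLelt s t^-1 T' v Y.
  apply: (KLelt_bar WD _ _ HT HT') => i Z; rewrite /T' /inverse_op -addrA; congr (_ + _).
  by rewrite -scaleNr -scalerDl; congr (_ *: _); rewrite /d; ring.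
have barTn v Y : KLelt s (- t^-1) T v Y = KLelt s (- t) T' v Y.
  apply: (KLelt_bar WD _ _ HTn HTn') => i Z; rewrite /T' /inverse_op -addrA; congr (_ + _).
  by rewrite -scaleNr -scalerDl; congr (_ *: _); rewrite /d; ring.
have ds : op_scalar T d := op_scalar_diff HT.
have TK i : cancel (T' i) (T i) := inverse_opK HT i.
have T'K i : cancel (T i) (T' i) := inverse_opVK HT i.
have TE i Y : T i Y = T' i Y - (- d) *: Y by rewrite scaleNr opprK subrK.
have sT k : op_scalar T' k -> op_scalar T k.
  move=> ck i Y; have := ck i Y.
  by rewrite /T' /inverse_op scalerBr !scalerA [d * k]mulrC => /addIr.
have sT' k : op_scalar T k -> op_scalar T' k := @op_scalar_inverse _ _ _ t T k.
(* Exactly one factor is barred in each expansion: the second in [E1], giving parameters t and -t,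
   the first in [E2], giving t^-1 and -t^-1. *)
have E1 : phi (KLelt s t T w (KLelt s (- t^-1) T u X)) = zeval t (inversion_poly w u) * kappa.
  rewrite barTn; apply: (phi_KLelt (T1 := T)) => // x y.
  by apply: (phi_inverse_op WD HT ds (T' := T')) => //; case: HTn'.
have E2 : phi (KLelt s t T w (KLelt s (- t^-1) T u X)) = zeval t^-1 (inversion_poly w u) * kappa.
  rewrite barT; apply: (phi_KLelt (T1 := T')) => //; first by rewrite invr_eq0.
  move=> x y; have nd : op_scalar T' (- d) by apply/sT'/(op_scalarN HT).
  by apply: (phi_inverse_op WD HT' nd (T' := T)) => //; case: HT.
rewrite E1; congr (_ * kappa).
rewrite (zeval_reciprocal t0 trans); last first.
  by apply: (mulIf kappa0); rewrite -E1 -E2.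
rewrite /inversion_poly horner_sum (bigD1 w) //= big1 => [|x xw].
  rewrite addr0 hornerM horner_comp hornerN hornerX oppr0 !KLpoly_at0 eqxx mul1r.
  by rewrite -(inj_eq (mulgI w)) mulKVg eq_sym; case: eqP.
by rewrite hornerM KLpoly_at0 (negPf xw) mul0r.
Qed.

End KLPolynomial.

(** * Demazure-Lusztig operators *)

Section Localization.
Variables (n : nat) (A : 'M[int]_n) (gT : finGroupType)
  (s : 'I_n -> gT) (lact : gT -> lat n -> lat n)
  (K : fieldType) (t : K) (e : lat n -> K) (act : gT -> K -> K).
Hypotheses (WD : weyl_datum A s lact) (CD : coeff_datum lact t e act).

Local Notation alpha := (alpha A).
Local Notation pos := (is_pos A).
Local Notation wp := (word_prod s).
Local Notation ell := (ell s).
Local Notation w0 := (w0 s).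
Local Notation posroots := (posroots A lact).
Local Notation V := {ffun gT -> K^o}.

Let e0 : e 0 = 1. Proof. by case: CD. Qed.
Let eD l m : e (l + m) = e l * e m. Proof. by case: CD => _ []. Qed.
Let indep (sq : seq (lat n)) (c : lat n -> {poly int}) : uniq sq ->
  \sum_(l <- sq) zeval t (c l) * e l = 0 -> forall l, l \in sq -> c l = 0.
Proof. by case: CD => _ [_ [ind _]]; apply: ind. Qed.
Let act_1 w : act w 1 = 1.
Proof. by case: CD => _ [_ [_ [H _]]]; case: (H w). Qed.
Let actD w a b : act w (a + b) = act w a + act w b.
Proof. by case: CD => _ [_ [_ [H _]]]; case: (H w) => _ /(_ a b) []. Qed.
Let actM w a b : act w (a * b) = act w a * act w b.
Proof. by case: CD => _ [_ [_ [H _]]]; case: (H w) => _ /(_ a b) []. Qed.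
Let act1 a : act 1%g a = a. Proof. by case: CD => _ [_ [_ [_ []]]]. Qed.
Let actMg x y a : act (x * y)%g a = act x (act y a).
Proof. by case: CD => _ [_ [_ [_ [_ []]]]]. Qed.
Let act_t w : act w t = t.
Proof. by case: CD => _ [_ [_ [_ [_ [_ []]]]]]. Qed.
Let e_act w l : e (lact w l) = act w (e l).
Proof. by case: CD => _ [_ [_ [_ [_ [_ [_]]]]]]. Qed.

Lemma t_transcendental (p : {poly int}) : zeval t p = 0 -> p = 0.
Proof.
move=> p0; apply: (@indep [:: 0] (fun=> p)) (mem_head _ _) => //.
by rewrite big_seq1 p0 mul0r.
Qed.

Lemma t_neq0 : t != 0.
Proof.
apply/eqP => t0; have /eqP : ('X : {poly int}) = 0.
  by apply: t_transcendental; rewrite map_polyX hornerX.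
by rewrite polyX_eq0.
Qed.

Lemma e_eq1 l : e l = 1 -> l = 0.
Proof.
move=> el; apply/eqP; apply/negPn/negP => l0.
have := @indep [:: l; 0] (fun m => if m == 0 then -1 else 1) _ _ l (mem_head _ _).
rewrite (negPf l0) => H; have /eqP : (1 : {poly int}) = 0.
  apply: H; first by rewrite /= inE l0.
  rewrite !big_cons big_nil (negPf l0) eqxx rmorph1 rmorphN rmorph1 hornerN !hornerC.
  by rewrite el e0 mul1r mulr1 addr0 subrr.
by rewrite oner_eq0.
Qed.

Lemma e_neq0 l : e l != 0.
Proof.
apply/eqP => el; have : e l * e (- l) = 1 by rewrite -eD subrr.
by rewrite el mul0r => /eqP; rewrite eq_sym oner_eq0.
Qed.

Lemma eN l : e (- l) = (e l)^-1.
Proof. by apply: (mulfI (e_neq0 l)); rewrite -eD subrr e0 mulfV ?e_neq0. Qed.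

Lemma eMn l k : e (l *+ k) = e l ^+ k.
Proof. by elim: k => [|k IH]; rewrite ?e0 // mulrS eD IH exprS. Qed.

Lemma eZ (c : int) l : e (c *: l) = e l ^ c.
Proof.
case: c => k; first by rewrite -[Posz k]natz scaler_nat eMn natz.
by rewrite NegzE -[Posz k.+1]natz scaleNr scaler_nat eN eMn natz.
Qed.

Lemma act0 w : act w 0 = 0.
Proof. by apply: (addrI (act w 0)); rewrite -actD !addr0. Qed.

Lemma actN w a : act w (- a) = - act w a.
Proof. by apply: (addrI (act w a)); rewrite -actD !subrr act0. Qed.

Lemma actK w : cancel (act w) (act w^-1%g).
Proof. by move=> a; rewrite -actMg mulVg act1. Qed.

Lemma act_eq0 w a : act w a = 0 -> a = 0.
Proof. by move=> wa; rewrite -(actK w a) wa act0. Qed.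

Lemma actV w a : act w a^-1 = (act w a)^-1.
Proof.
have [->|a0] := eqVneq a 0; first by rewrite invr0 act0 invr0.
have wa0 : act w a != 0 by apply: contra a0 => /eqP/act_eq0 ->.
by apply: (mulfI wa0); rewrite -actM !mulfV // act_1.
Qed.

Lemma act_sum w (I : Type) (r : seq I) (P : pred I) F :
  act w (\sum_(x <- r | P x) F x) = \sum_(x <- r | P x) act w (F x).
Proof. by apply: (big_morph _ (actD w) (act0 w)). Qed.

Lemma act_prod w (I : Type) (r : seq I) (P : pred I) F :
  act w (\prod_(x <- r | P x) F x) = \prod_(x <- r | P x) act w (F x).
Proof. by apply: (big_morph _ (actM w) (act_1 w)). Qed.

(** The two coefficients of tau_i, extended from alpha_i to every weight so that W permutes them. *)
Definition dl_diag (b : lat n) : K := (t^-1 - t) / (1 - e (- b)).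
Definition dl_lead (b : lat n) : K := (t - t^-1 * e (- b)) / (1 - e (- b)).

Lemma act_diag w b : act w (dl_diag b) = dl_diag (lact w b).
Proof.
by rewrite /dl_diag actM actV !actD !actN !actV act_t act_1 -e_act (lactN WD).
Qed.

Lemma act_lead w b : act w (dl_lead b) = dl_lead (lact w b).
Proof.
by rewrite /dl_lead actM actV !actD !actN !actM !actV act_t act_1 -e_act (lactN WD).
Qed.

Lemma one_sub_e_neq0 b : b != 0 -> 1 - e b != 0.
Proof. by apply: contra; rewrite subr_eq0 => /eqP /esym /e_eq1 ->. Qed.

(** Otherwise t^2 = e^(-b), contradicting independence of e^0 and e^(-b) over Z[t]. This makes
    [kappa] cancellable. *)
Lemma lead_num_neq0 b : b != 0 -> t - t^-1 * e (- b) != 0.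
Proof.
move=> b0; apply/eqP => /(congr1 (fun z => t * z)).
rewrite mulrBr mulrA mulfV ?t_neq0 // mul1r mulr0 => tb.
have nb0 : - b != 0 by rewrite oppr_eq0.
have := @indep [:: - b; 0] (fun m => if m == 0 then 'X^2 else -1) _ _ (- b) (mem_head _ _).
rewrite (negPf nb0) => H; have /eqP : (-1 : {poly int}) = 0.
  apply: H; first by rewrite /= inE nb0.
  rewrite !big_cons big_nil (negPf nb0) eqxx map_polyXn hornerXn rmorphN rmorph1 hornerN hornerC.
  by rewrite e0 mulN1r mulr1 addr0 addrC expr2.
by rewrite oppr_eq0 oner_eq0.
Qed.

Lemma dl_diagN b : b != 0 -> dl_diag b + dl_diag (- b) = t^-1 - t.
Proof.
move=> b0; rewrite /dl_diag opprK [e (- b)]eN.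
have := one_sub_e_neq0 b0; have := e_neq0 b; set x := e b => x0 x1.
have x2 : 1 - x^-1 != 0 by rewrite subr_eq0 -invr1 (inj_eq invr_inj) -subr_eq0.
by field; rewrite t_neq0 x0 x1 -opprB oppr_eq0 x1.
Qed.

Lemma dl_leadN b : b != 0 -> dl_lead b * dl_lead (- b) = 1 + dl_diag b * dl_diag (- b).
Proof.
move=> b0; rewrite /dl_diag /dl_lead opprK [e (- b)]eN.
have := one_sub_e_neq0 b0; have := e_neq0 b; set x := e b => x0 x1.
have x2 : 1 - x^-1 != 0 by rewrite subr_eq0 -invr1 (inj_eq invr_inj) -subr_eq0.
by field; rewrite t_neq0 x0 x1 -opprB oppr_eq0 x1.
Qed.

Definition lead_op i (X : V) : V :=
  [ffun u => dl_lead (alpha i) * act (s i) (X (s i * u)%g)].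

Definition tau_op i (X : V) : V := qmul act (tau A s t e i) X.

Lemma qmul_deltal w (X : V) u : (\sum_v delta K w v * act v (X (v^-1 * u)%g))
  = act w (X (w^-1 * u)%g).
Proof.
rewrite (bigD1 w) //= ffunE eqxx mul1r big1 ?addr0 // => v /negPf vw.
by rewrite ffunE vw mul0r.
Qed.

Lemma tau_opE i X : tau_op i X = dl_diag (alpha i) *: X + lead_op i X.
Proof.
apply/ffunP => u; rewrite !ffunE.
under eq_bigr do rewrite !ffunE mulrDl -!mulrA.
rewrite big_split /= -!mulr_sumr.
have dE w : \sum_v (v == w)%:R * act v (X (v^-1 * u)%g) = act w (X (w^-1 * u)%g).
  by rewrite -qmul_deltal; apply: eq_bigr => v _; rewrite ffunE.
by rewrite !dE invg1 mul1g act1 (sV WD) !mulrA.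
Qed.

Lemma lead_opD i X Y : lead_op i (X + Y) = lead_op i X + lead_op i Y.
Proof. by apply/ffunP => u; rewrite !ffunE actD mulrDr. Qed.

Lemma lead_opZ i k X : lead_op i (k *: X) = act (s i) k *: lead_op i X.
Proof. by apply/ffunP => u; rewrite !ffunE actM mulrCA. Qed.

Lemma lead_op2 i X :
  lead_op i (lead_op i X) = (1 + dl_diag (alpha i) * dl_diag (- alpha i)) *: X.
Proof.
apply/ffunP => u; rewrite !ffunE actM -actMg (ss1 WD) act1 (sK WD) mulrA.
by rewrite act_lead (alpha_refl WD) dl_leadN ?(alpha_neq0 WD).
Qed.

Definition inversions (u : seq 'I_n) : seq (lat n) :=
  foldr (fun i bs => alpha i :: map (lact (s i)) bs) [::] u.

Lemma lead_op_word u X v : foldr lead_op X u v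
  = \prod_(b <- inversions u) dl_lead b * act (wp u) (X ((wp u)^-1 * v)%g).
Proof.
elim: u v => [|i u IH] v.
  by rewrite big_nil word_prod_nil invg1 !mul1g mul1r act1.
rewrite /= ffunE IH big_cons big_map word_prod_cons -mulrA; congr (_ * _).
rewrite actM act_prod actMg invMg (sV WD) mulgA; congr (_ * _).
by apply: eq_bigr => b _; rewrite act_lead.
Qed.

(** An instance of [braid_rank2] with c = t^-1 - t, x = e^(-alpha_i), y = e^(-alpha_j). Its
    hypothesis on the two longest words holds since they have the same product in W and the same
    inversions up to order. *)
Lemma tau_op_braid : satisfies_braid A tau_op.
Proof.
move=> i j m X ij mP.
set a := - A i j in mP; set b := - A j i in mP.
pose av r := dl_diag (pair_root A i j r).
pose S l := act (s (pair_letter i j l)).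
pose D l := lead_op (pair_letter i j l).
have fold_map l k : foldr tau_op X (map (pair_letter i j) (alt_word l (~~ l) k))
    = foldr (rank2_op D av) X (alt_word l (~~ l) k).
  elim: (alt_word l (~~ l) k) => //= l' u ->.
  by rewrite tau_opE /rank2_op /av (pair_root_simple A i j l').
rewrite (alt_word_map i j m false) (alt_word_map i j m true) !fold_map /=.
have inv_pair u : inversions (map (pair_letter i j) u)
    = map (pair_root A i j) (rank2_inv A i j u).
  elim: u => //= l u ->; rewrite pair_root_simple; congr (_ :: _).
  by rewrite -!map_comp; apply: eq_map => r /=; rewrite (lact_pair_root WD).
have D_word u Y : foldr D Y u = foldr lead_op Y (map (pair_letter i j) u).
  by elim: u => //= l u ->.
have DD l f g : D l (f + g) = D l f + D l g by apply: lead_opD.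
have DZ l k f : D l (k *: f) = S l k *: D l f by apply: lead_opZ.
have S1 l : S l 1 = 1 by apply: act_1.
have SM l x y : S l (x * y) = S l x * S l y by apply: actM.
have Sav l r : S l (av r) = av (rank2_refl a b l r).
  by rewrite /S /av act_diag (lact_pair_root WD).
have D2 l f : D l (D l f) = (1 + av (rank2_simple l) * av (rank2_opp l)) *: f.
  by rewrite /D lead_op2 /av pair_root_simple pair_root_opp.
have pair_e p q : e (- pair_root A i j (p, q)) = e (- alpha i) ^ p * e (- alpha j) ^ q.
  by rewrite /pair_root opprD eD -!scalerN !eZ.
have avE p q : av (p, q) = (t^-1 - t) / (1 - e (- alpha i) ^ p * e (- alpha j) ^ q).
  by rewrite /av /dl_diag pair_e.
have xy1 (p q : nat) : (0 < p + q)%N -> 1 - e (- alpha i) ^+ p * e (- alpha j) ^+ q != 0.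
  move=> pq; have -> : e (- alpha i) ^+ p * e (- alpha j) ^+ q
    = e (- pair_root A i j (Posz p, Posz q)) by rewrite pair_e.
  apply: one_sub_e_neq0.
  rewrite oppr_eq0; apply/eqP => /(pair_root_eq0 WD ij) [[p0] [q0]].
  by rewrite p0 q0 in pq.
apply: (braid_rank2 DD DZ S1 SM Sav D2 (e_neq0 _) (e_neq0 _) xy1 avE mP).
rewrite /alt_op !D_word; apply/ffunP => v; rewrite !lead_op_word !inv_pair /=.
rewrite -(alt_word_map i j m false) -(alt_word_map i j m true) /= (group_braid WD mP).
congr (_ * _); apply: perm_big; apply: perm_map; exact: (rank2_inv_perm mP).
Qed.

Lemma op_scalar_tau k : (forall w, act w k = k) -> op_scalar tau_op k.
Proof.
move=> ck i X; rewrite !tau_opE lead_opZ ck scalerDr !scalerA.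
by rewrite [k * _]mulrC.
Qed.

Lemma hecke_action_tau : hecke_action A t tau_op.
Proof.
split; [exact: t_neq0 | | | | exact: tau_op_braid].
- by move=> i X Y; rewrite !tau_opE scalerDr lead_opD addrACA.
- by apply: op_scalar_tau => w; rewrite act_t.
move=> i X; rewrite !tau_opE lead_opD lead_opZ lead_op2 act_diag (alpha_refl WD).
have := dl_diagN (alpha_neq0 WD i); set x := dl_diag _; set y := dl_diag (- _) => xy.
rewrite -xy; move: (lead_op i X) => Y; apply/ffunP => u.
by rewrite !ffunE /GRing.scale /=; ring.
Qed.

Definition delta1 : V := delta K 1%g.

(** * Leading terms of products of Demazure-Lusztig operators *)

Section LeadingTerm.
Variables (O : 'I_n -> V -> V) (d : 'I_n -> K).
Hypothesis OE : forall i X, O i X = d i *: X + lead_op i X.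

(** Each letter extends the support by at most one in length. The diagonal coefficients [d] stay
    arbitrary, so that tau_i and its inverse are treated together. *)
Lemma foldr_op_high u v : (size u < ell v)%N -> foldr O delta1 u v = 0.
Proof.
elim: u v => [|i u IH] v /= uv.
  by rewrite ffunE; case: eqP => // v1; rewrite v1 (ell1 s) in uv.
rewrite OE !ffunE (IH v) ?(ltnW uv) // (IH (s i * v)%g) ?act0 ?mulr0 ?scaler0 ?addr0 //.
by have := ell_sl_le WD i (s i * v)%g; rewrite (sK WD) => /(leq_trans uv).
Qed.

Lemma foldr_op_lead u v : reduced s u -> (size u <= ell v)%N ->
  foldr O delta1 u v = (wp u == v)%:R
    * \prod_(b <- posroots | `[< pos (- lact (wp u)^-1%g b) >]) dl_lead b.
Proof.
elim: u v => [|i u IH] v red uv /=.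
  rewrite ffunE eq_sym word_prod_nil big1_seq ?mulr1 // => b /andP [/asboolP nb].
  case/mem_posroots => rb pb; case: (root_posN WD rb pb).
  by move: nb; rewrite invg1; case: WD => _ [->].
rewrite OE !ffunE (@foldr_op_high u v) // scaler0 add0r (IH (s i * v)%g); last 2 first.
- exact: reduced_tail WD _ _ red.
- by have := ell_sl_le WD i (s i * v)%g; rewrite (sK WD) => /(leq_trans uv).
rewrite word_prod_cons prod_inversions_cons //; last first.
  by rewrite -word_prod_cons -red /= ltnS; apply: ell_le.
rewrite actM act_prod mulrCA; congr (_ * (_ * _)).
  by rewrite -(inj_eq (mulgI (s i))) (sK WD); case: eqP; rewrite ?act_1 ?act0.
by apply: eq_bigr => b _; rewrite act_lead.
Qed.

Lemma word_op_at_w0 x : word_op s O x delta1 w0 = (x == w0)%:R * \prod_(b <- posroots) dl_lead b.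
Proof.
have [sx xE] := rwordP WD x; rewrite /word_op foldr_op_lead ?sx ?(ell_w0_max s) //; last first.
  exact: (reduced_rword WD).
rewrite xE; case: eqP => [->|]; last by rewrite !mul0r.
congr (_ * _); rewrite big_seq_cond [RHS]big_seq; apply: eq_bigl => b.
have [bp|//] := boolP (b \in posroots); apply/asboolP.
by rewrite (w0V WD); apply: (w0_pos WD); case/mem_posroots: bp.
Qed.

End LeadingTerm.

(** * From the algebra product to the pairing *)

Lemma qmulA (a b c : V) : qmul act (qmul act a b) c = qmul act a (qmul act b c).
Proof.
apply/ffunP => u; rewrite !ffunE.
transitivity (\sum_w \sum_v a v * act v (b (v^-1 * w)%g) * act w (c (w^-1 * u)%g)).
  by apply: eq_bigr => w _; rewrite ffunE mulr_suml.
rewrite exchange_big /=; apply: eq_bigr => v _.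
rewrite ffunE act_sum mulr_sumr (reindex_inj (mulgI v)) /=; apply: eq_bigr => w _.
by rewrite mulKg invMg actM actMg mulrA mulgA.
Qed.

Lemma qmul1 (X : V) : qmul act delta1 X = X.
Proof. by apply/ffunP => u; rewrite ffunE qmul_deltal invg1 mul1g act1. Qed.

Lemma tauw_mul w (X : V) : qmul act (tauw A s t e act w) X = word_op s tau_op w X.
Proof.
rewrite /tauw /word_op; elim: (rword s w) => [|i u IH] /=; first exact: qmul1.
by rewrite [LHS]qmulA IH.
Qed.

Lemma gammaE w : Defs.gamma A s t e act w = KLelt s t tau_op w delta1.
Proof.
apply/ffunP => u; rewrite !ffunE sum_ffunE big_enum /=; apply: eq_bigr => x _.
rewrite !ffunE /KLval /KLev /tpow; case: ifP => // /negbT nb.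
by rewrite (KL_nbruhat WD nb) rmorph0 horner0 mulr0.
Qed.

(** At q = -t^-1 the powers of q in [KLval] produce the signs and invert t, while q^-2 becomes
    t^2. *)
Lemma gammatE w : gammat A s t e act w = KLelt s (- t^-1) tau_op w delta1.
Proof.
apply/ffunP => u; rewrite !ffunE sum_ffunE big_enum /=; apply: eq_bigr => x _.
rewrite !ffunE /KLval /KLev /tpow /eps; congr (_ * _ * _).
  by rewrite ![(- t^-1) ^+ _]exprNn !exprVn invfM invrK invr_sign; ring.
by rewrite sqrrN exprVn invrK.
Qed.

Lemma scale_ffunE k (X : V) u : (k *: X) u = k * X u.
Proof. by rewrite ffunE. Qed.

Lemma qmulE (a X : V) u : (qmul act a X : V) u = \sum_v a v * act v (X (v^-1 * u)%g).
Proof. by rewrite ffunE. Qed.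

Lemma qmul_KLelt w (X : V) :
  qmul act (Defs.gamma A s t e act w) X = KLelt s t tau_op w X.
Proof.
rewrite gammaE; apply/ffunP => u; rewrite ffunE [RHS]sum_ffunE.
under eq_bigr do rewrite sum_ffunE mulr_suml.
rewrite exchange_big /=; apply: eq_bigr => x _.
rewrite [RHS]scale_ffunE -(tauw_mul x X) qmulE mulr_sumr; apply: eq_bigr => v _.
by rewrite scale_ffunE mulrA.
Qed.

(** The map b -> -w0 b permutes the positive roots. The result is the product of the denominators in
    [kappa]. *)
Lemma act_w0_xPi : act w0 (xPi A lact e) = \prod_(b <- posroots) (1 - e (- b)).
Proof.
rewrite /xPi act_prod.
under eq_bigr do rewrite /xl opprK actD actN act_1 -e_act.
have pm : perm_eq [seq - lact w0 b | b <- posroots] posroots.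
  have inj : injective (fun b => - lact w0 b) by move=> b c /oppr_inj /(lact_inj WD).
  have sub : {subset [seq - lact w0 b | b <- posroots] <= posroots}.
    move=> x /mapP [b /mem_posroots [rb pb] {x}->]; apply/mem_posroots; split.
      by apply: (is_root_opp WD); apply: (is_root_act WD).
    exact: (w0_pos WD).
  have un : uniq [seq - lact w0 b | b <- posroots].
    by rewrite (map_inj_uniq inj) posroots_uniq.
  apply: uniq_perm; rewrite ?posroots_uniq //.
  by apply: (uniq_min_size un sub _).2; rewrite size_map.
by rewrite -[RHS](perm_big _ pm) big_map; apply: eq_bigr => b _; rewrite opprK.
Qed.

Lemma posroot_neq0 b : b \in posroots -> b != 0.
Proof. by case/mem_posroots => /(is_root_neq0 WD). Qed.

Lemma xPi_neq0 : xPi A lact e != 0.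
Proof.
rewrite /xPi big_seq; elim/big_ind: _ => [|x y x0 y0|b bp]; first exact: oner_neq0.
  exact: mulf_neq0.
by rewrite /xl opprK; apply/one_sub_e_neq0/posroot_neq0.
Qed.

(** In the summand at u, the restriction of C_w carries u(x_Pi), which cancels the denominator. What
    remains is the convolution term for w0 = u (u^-1 w0), times w0(x_Pi). *)
Lemma pairing_KL w v :
  pairing A lact e act (KLC A s lact t e act w) (KLCt A s lact t e act v)
  = act w0 (xPi A lact e) * KLelt s t tau_op w
      (KLelt s (- t^-1) tau_op (v^-1 * w0)%g delta1) w0.
Proof.
rewrite -qmul_KLelt -gammatE ffunE mulr_sumr /pairing; apply: eq_bigr => u _.
have -> : KLC A s lact t e act w u
    = Defs.gamma A s t e act w u * act u (xPi A lact e).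
  rewrite ffunE (bigD1 u) //= big1 ?addr0 => [|y yu].
    by rewrite !ffunE mulVg eqxx act1.
  rewrite [X in _ * act _ X]ffunE; case: ifP => [/eqP E|_]; last by rewrite act0 mulr0.
  by move: yu; rewrite -[y]mulg1 -E mulKVg eqxx.
have -> : KLCt A s lact t e act v u
    = act u (gammat A s t e act (v^-1 * w0)%g (u^-1 * w0)%g) * act w0 (xPi A lact e).
  rewrite ffunE (bigD1 (u^-1 * w0)%g) //= big1 ?addr0 => [|y yu].
    by rewrite !ffunE mulKVg eqxx.
  rewrite [X in _ * X]ffunE; case: ifP => [/eqP E|_]; last by rewrite mulr0.
  by move: yu; rewrite -E mulKg eqxx.
have ux : act u (xPi A lact e) != 0 by apply: contra xPi_neq0 => /eqP/act_eq0 ->.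
by field.
Qed.

Lemma inverse_tau_op i X :
  inverse_op tau_op (t^-1 - t) i X = (dl_diag (alpha i) - (t^-1 - t)) *: X + lead_op i X.
Proof. by rewrite /inverse_op tau_opE addrAC -scalerBl. Qed.

End Localization.

Theorem theorem4p2 (n : nat) (A : 'M[int]_n) (gT : finGroupType)
    (s : 'I_n -> gT) (lact : gT -> lat n -> lat n)
    (K : fieldType) (t : K) (e : lat n -> K) (act : gT -> K -> K) :
  weyl_datum A s lact ->
  coeff_datum lact t e act ->
  forall w v : gT,
    pairing A lact e act (KLC A s lact t e act w) (KLCt A s lact t e act v)
    = (w == v)%:R * \prod_(b <- posroots A lact) (t - t^-1 * e (- b)).
Proof.
move=> WD CD w v; rewrite (pairing_KL WD CD).
pose phi (X : {ffun gT -> K^o}) : K := X (w0 s).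
set kappa := \prod_(b <- posroots A lact) dl_lead t e b.
have prodE : act (w0 s) (xPi A lact e) * kappa
    = \prod_(b <- posroots A lact) (t - t^-1 * e (- b)).
  rewrite (act_w0_xPi WD CD) -big_split /=; apply: eq_big_seq => b bp.
  rewrite mulrC divfK //; apply: (one_sub_e_neq0 CD).
  by rewrite oppr_eq0 (posroot_neq0 WD bp).
have kappa0 : kappa != 0.
  suff : \prod_(b <- posroots A lact) (t - t^-1 * e (- b)) != 0.
    by apply: contra => /eqP k0; rewrite -prodE k0 mulr0.
  rewrite big_seq; elim/big_ind: _ => [|x y x0 y0|b bp]; first exact: oner_neq0.
    exact: mulf_neq0.
  by apply: (lead_num_neq0 CD); apply: (posroot_neq0 WD bp).
rewrite -/(phi _) (phi_KLelt_oppV (phi := phi) WD (hecke_action_tau WD CD) (t_transcendental CD)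
  (kappa := kappa)) //.
- rewrite mulrCA prodE; congr (_ * _); congr (_%:R).
  rewrite mulgA -{2}(mul1g (w0 s)) (inj_eq (mulIg (w0 s))) -(inj_eq (mulIg v)) mulgKV mul1g.
  by [].
- by move=> X Y; rewrite /phi ffunE.
- by move=> k X; rewrite /phi ffunE.
- by move=> x; rewrite /phi (word_op_at_w0 WD CD (tau_opE WD CD)).
- by move=> x; rewrite /phi (word_op_at_w0 WD CD (inverse_tau_op WD CD)).
Qed.
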